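(* Let $P$ be a finite graded poset of rank $r$ with flag ideal $\mathcal{F}(P)$. The ideal $\mathcal{F}(P)$ has a linear resolution if and only if for every $i=1,\ldots,r-1$ the Hasse diagram of $P_{i,i+1}$ is a Ferrers graph. In particular, if $\mathcal{F}(P)$ has a linear resolution then $P$ is connected.
   Context: Let $\Bbbk$ be a field. A finite poset $P$ is graded if it has a rank function $r_P:P\to\mathbb{N}$ with $r_P(p)=1$ for every minimal element $p$ and $r_P(q)=r_P(p)+1$ whenever $q$ covers $p$; the rank of $P$ is $\max\{r_P(p): p\in P\}$. $P_{i,i+1}$ is the induced subposet of $P$ on the elements of rank $i$ and $i+1$; its Hasse diagram is viewed as a bipartite graph with parts the elements of rank $i$ and the elements of rank $i+1$. The flag ideal $\mathcal{F}(P)\subseteq\Bbbk[x_p: p\in P]$ is the squarefree monomial ideal generated by all monomials $x_{p_1}\cdots x_{p_n}$ with $p_1<\cdots<p_n$ a maximal chain of $P$. A Ferrers graph is a bipartite graph $G$ on two disjoint vertex sets that can be labeled $\{x_1,\ldots,x_n\}$ and $\{y_1,\ldots,y_m\}$ such that: (1) if $\{x_p,y_q\}$ is an edge of $G$, then for all $i<p$ and $j<q$, $\{x_i,y_j\}$ is an edge of $G$ as well; and (2) $\{x_1,y_m\}$ and $\{x_n,y_1\}$ are edges of $G$. $P$ is connected if any two elements $a,b$ are joined by a sequence $a=p_0,\ldots,p_n=b$ in $P$ with $p_i\le p_{i+1}$ or $p_{i+1}\le p_i$ for all $i$.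
   Formalization: Condition (1) of a Ferrers graph is taken with i ≤ p and j ≤ q (with strict inequalities two disjoint edges would qualify and the equivalence fails), and connectedness is claimed only for rank r > 1, since an antichain with at least two elements is a counterexample for r = 1. *)

(* Defs.v *)
From HB Require Import structures.
From mathcomp Require Import all_boot all_order all_algebra.
From mathcomp Require Import mpoly.

Set Implicit Arguments.
Unset Strict Implicit.
Unset Printing Implicit Defensive.

Import Order.TTheory GRing.Theory.
Local Open Scope ring_scope.

Section FreeResolutions.
Variables (n : nat) (k : fieldType).
Local Notation S := {mpoly k[n]}.

(* Elements of the free module of rank b are row vectors 'rV[S]_b, and an
   r x s matrix A is the map S^r -> S^s sending w to w *m A.  The basis
   vector e_v of F_i has degree [gfr_shift i v], that is
   F_i = \bigoplus_v S(- gfr_shift i v); the maps preserve degrees.  A minimal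
   resolution of an ideal of S only has shifts in nat. *)
Record graded_free_resolution (I : S -> Prop) := GradedFreeResolution {
  gfr_rank : nat -> nat;
  gfr_shift : forall i, 'I_(gfr_rank i) -> nat;
  gfr_aug : 'cV[S]_(gfr_rank 0);
  gfr_diff : forall i, 'M[S]_(gfr_rank i.+1, gfr_rank i);
  gfr_aug_homog : forall v, gfr_aug v ord0 \is (gfr_shift v).-homog;
  gfr_diff_homog : forall i (u : 'I_(gfr_rank i.+1)) (v : 'I_(gfr_rank i)),
    if (gfr_shift v <= gfr_shift u)%N
    then gfr_diff i u v \is (gfr_shift u - gfr_shift v)%N.-homog
    else gfr_diff i u v == 0;
  gfr_image_aug : forall f : S,
    I f <-> exists w : 'rV[S]_(gfr_rank 0), f = (w *m gfr_aug) ord0 ord0;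
  gfr_exact_aug : forall w : 'rV[S]_(gfr_rank 0),
    w *m gfr_aug = 0 <->
    exists z : 'rV[S]_(gfr_rank 1), w = z *m gfr_diff 0;
  gfr_exact : forall i (w : 'rV[S]_(gfr_rank i.+1)),
    w *m gfr_diff i = 0 <->
    exists z : 'rV[S]_(gfr_rank i.+2), w = z *m gfr_diff i.+1
}.

(* Every differential maps into the multiple of its target by the maximal
   ideal generated by the variables. *)
Definition minimal_resolution (I : S -> Prop) (F : graded_free_resolution I) :=
  forall i (u : 'I_(gfr_rank F i.+1)) (v : 'I_(gfr_rank F i)),
    (gfr_diff F i u v)@_0%MM = 0.

(* F_i = S(-(d + i))^(b_i) for all i. *)
Definition linear_shifts (I : S -> Prop) (F : graded_free_resolution I) :=
  exists d : nat, forall i (v : 'I_(gfr_rank F i)), gfr_shift v = (d + i)%N.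

(* Minimal graded free resolutions exist and are unique up to isomorphism, so
   the existential speaks about the minimal graded free resolution of I. *)
Definition has_linear_resolution (I : S -> Prop) :=
  exists2 F : graded_free_resolution I,
    minimal_resolution F & linear_shifts F.

End FreeResolutions.

Section Posets.
Variables (d : Order.disp_t) (P : finPOrderType d).
Implicit Types (A C : {set P}) (p q : P) (rk : P -> nat).

(* q covers p in the subposet of P induced on A. *)
Definition covers_in A p q : bool :=
  [&& p \in A, q \in A, (p < q)%O
    & [forall z in A, ~~ ((p < z)%O && (z < q)%O)]].

Definition covers p q : bool := covers_in [set: P] p q.

Definition hasse_in A : rel P := fun p q => covers_in A p q || covers_in A q p.

Definition minimal_elt p : bool := [forall q, ~~ (q < p)%O].

Definition rank_function rk : Prop :=
  (forall p, minimal_elt p -> rk p = 1%N) /\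
  (forall p q, covers p q -> rk q = (rk p).+1).

Definition poset_rank rk : nat := \max_(p : P) rk p.

Definition rank_level rk i : {set P} := [set p | rk p == i].

Definition consecutive_levels rk i : {set P} :=
  rank_level rk i :|: rank_level rk i.+1.

Definition poset_connected : Prop :=
  forall a b : P, connect (fun p q : P => (p <= q)%O || (q <= p)%O) a b.

Definition is_chain C : bool :=
  [forall p in C, forall q in C, (p <= q)%O || (q <= p)%O].

Definition maximal_chain C : bool := maxset is_chain C.

Definition chain_monomial (k : fieldType) C : {mpoly k[#|P|]} :=
  \prod_(p in C) 'X_(enum_rank p).

Definition flag_ideal (k : fieldType) (f : {mpoly k[#|P|]}) : Prop :=
  exists c : {set P} -> {mpoly k[#|P|]},
    f = \sum_(C : {set P} | maximal_chain C) c C * chain_monomial k C.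

End Posets.

Section Ferrers.
Variable T : finType.
Implicit Types (X Y : {set T}) (e : rel T).

Definition bipartite_graph X Y e : Prop :=
  [/\ [disjoint X & Y], ssrbool.symmetric e
    & forall u v, e u v ->
        (u \in X) && (v \in Y) || (u \in Y) && (v \in X)].

(* The labels x_1, ..., x_(n+1) and y_1, ..., y_(m+1) are indexed from 0 here;
   the corner condition forces both parts to be nonempty.  The closure
   condition uses weak inequalities, as in Corso and Nagel: with strict ones
   two disjoint edges would form a Ferrers graph (x_1 y_2 and x_2 y_1). *)
Definition ferrers_graph X Y e : Prop :=
  bipartite_graph X Y e /\
  exists (n m : nat) (x : 'I_n.+1 -> T) (y : 'I_m.+1 -> T),
    [/\ injective x /\ x @: 'I_n.+1 = X,
        injective y /\ y @: 'I_m.+1 = Y,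
        forall p q, e (x p) (y q) ->
          forall (i : 'I_n.+1) (j : 'I_m.+1),
            (i <= p)%N -> (j <= q)%N -> e (x i) (y j)
      & e (x ord0) (y ord_max) /\ e (x ord_max) (y ord0)].

End Ferrers.

(* Main.v *)
(* Call a set of elements of P a cell if it meets every level 1..r and any two
   of its elements on consecutive levels are comparable: a cell is a product of
   simplices, one on each level, and the cells of size r are the maximal chains
   when every element of rank less than r has an upper cover.

   If all P_{i,i+1} are Ferrers graphs, the cells of size r + i index a basis of
   the i-th module of a linear cellular resolution of the flag ideal.  Its
   strand of multidegree b is the complex of cells contained in the support
   of b.  It is acyclic: going down from level r to level 1, each level is
   collapsed onto a vertex g of the support with largest lower neighbourhood
   among those below the vertex chosen last, since adding g to a cell gives a
   cell.

   Conversely, a linear resolution forces all maximal chains to have the same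
   size, and its first syzygies are linear.  If a < b and a' < b' on levels i,
   i+1 were such that neither a < b' nor a' < b, the syzygy between maximal
   chains through {a, b} and through {a', b'} would not be generated by linear
   ones.  Hence neighbourhoods are nested, and sorting each level by the size of
   its neighbourhoods gives a Ferrers labelling. *)
Require Import Defs.
From mathcomp Require Import all_boot all_order all_algebra.
From mathcomp Require Import mpoly.

Set Implicit Arguments.
Unset Strict Implicit.
Unset Printing Implicit Defensive.

Import Order.TTheory GRing.Theory.
Local Open Scope ring_scope.

(** * The complex of cells *)

Section CellComplex.
Variables (T : finType) (e : rel T) (rk : T -> nat) (r : nat).
Implicit Types (s t : {set T}) (u v p q : T).

Definition cell s : bool :=
  [forall i : 'I_r, exists p in s, rk p == i.+1] &&
  [forall p in s, forall q in s, (rk q == (rk p).+1) ==> e p q].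

Lemma cellP s :
  reflect ((forall i, (0 < i <= r)%N -> exists2 p, p \in s & rk p = i) /\
           {in s &, forall p q, rk q = (rk p).+1 -> e p q})
          (cell s).
Proof.
apply: (iffP andP) => -[meet edge]; split.
- case=> // i /= lt_ir; have /forallP/(_ (Ordinal lt_ir)) := meet.
  by case/existsP=> p /andP[ps /eqP rkp]; exists p.
- move=> p q ps qs rkq; have /forall_inP/(_ p ps)/forall_inP/(_ q qs) := edge.
  by rewrite rkq eqxx.
- apply/forallP=> i; have [|p ps rkp] := meet i.+1; first exact: ltn_ord.
  by apply/existsP; exists p; rewrite ps rkp /=.
- apply/forall_inP=> p ps; apply/forall_inP=> q qs.
  by apply/implyP=> /eqP; apply: edge.
Qed.

(** Meeting every level passes to larger sets, the edge condition to smaller ones. *)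
Lemma cell_between s t t' : cell s -> cell t' -> s \subset t -> t \subset t' ->
  cell t.
Proof.
move=> /cellP[meet _] /cellP[_ edge] /subsetP st /subsetP tt'.
apply/cellP; split=> [i /meet[p /st]|p q /tt' ? /tt' ?]; first by exists p.
exact: edge.
Qed.

Lemma cell_remove s u v : cell s -> u \in s -> v \in s -> u != v ->
  rk u = rk v -> cell (s :\ u).
Proof.
move=> /cellP[meet edge] us vs uv eq_rk; apply/cellP; split=> [i /meet[p ps <-]|].
  have [->|pu] := eqVneq p u; last by exists p; rewrite ?inE ?pu.
  by exists v; rewrite ?inE 1?eq_sym ?uv.
by move=> p q /setD1P[_ ps] /setD1P[_ qs]; apply: edge.
Qed.

(** Levels are coded by [inord] as the nonzero elements of ['I_r.+1], which turns statements about
    ranks into counts in a finite set. *)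
Lemma cell_levels s : cell s ->
  [set i : 'I_r.+1 | i != ord0] \subset [set inord (rk p) | p in s].
Proof.
move=> /cellP[meet _]; apply/subsetP=> i; rewrite inE -val_eqE /= -lt0n => i0.
have [|p ps rkp] := meet i; first by rewrite i0 -ltnS ltn_ord.
by apply/imsetP; exists p => //; apply/val_inj; rewrite /= inordK rkp.
Qed.

Lemma card_levels : #|[set i : 'I_r.+1 | i != ord0]| = r.
Proof. by rewrite cardsE cardC1 card_ord. Qed.

Lemma cell_card s : cell s -> (r <= #|s|)%N.
Proof.
move=> /cell_levels/subset_leq_card; rewrite card_levels => /leq_trans; apply.
exact: leq_imset_card.
Qed.

(** The ranks in [s] fill [r] levels, so [r] vertices leave no room for a repetition. *)
Lemma cell_rank_inj s : cell s -> #|s| = r -> {in s &, injective rk}.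
Proof.
move=> cs sr; suff /imset_injP inj : #|[set (inord (rk p) : 'I_r.+1) | p in s]| == #|s|.
  by move=> p q ps qs eq_rk; apply: inj => //; rewrite eq_rk.
rewrite eqn_leq leq_imset_card sr.
by have := subset_leq_card (cell_levels cs); rewrite card_levels.
Qed.

Hypothesis rk_bound : forall p, (0 < rk p <= r)%N.

Lemma rank_levels s : {in s &, injective rk} ->
  #|[set (inord (rk p) : 'I_r.+1) | p in s]| = #|s| /\
  [set (inord (rk p) : 'I_r.+1) | p in s] \subset [set i | i != ord0].
Proof.
have lt_rk p : (rk p < r.+1)%N by have /andP[] := rk_bound p.
move=> inj; split.
  apply: card_in_imset => p q ps qs /(congr1 val).
  by rewrite /= !inordK ?lt_rk //; apply: inj.
apply/subsetP=> _ /imsetP[p _ ->]; have /andP[p0 _] := rk_bound p.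
by rewrite inE -val_eqE /= inordK ?lt_rk // -lt0n.
Qed.

Lemma rank_inj_card s : {in s &, injective rk} -> (#|s| <= r)%N.
Proof.
case/rank_levels=> <- /subset_leq_card; by rewrite card_levels.
Qed.

Lemma rank_inj_meet s i : {in s &, injective rk} -> #|s| = r -> (0 < i <= r)%N ->
  exists2 p, p \in s & rk p = i.
Proof.
move=> /rank_levels[card_s sub] sr /andP[i0 ir].
have /eqP eq_lev : [set (inord (rk p) : 'I_r.+1) | p in s] == [set j | j != ord0].
  by rewrite eqEcard sub card_s card_levels sr leqnn.
have : inord i \in [set j : 'I_r.+1 | j != ord0].
  by rewrite inE -val_eqE /= inordK // -lt0n.
rewrite -eq_lev => /imsetP[p ps /(congr1 val) /= rkp]; exists p => //.
by move: rkp; rewrite !inordK //; have /andP[] := rk_bound p.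
Qed.

(** * Signed boundary and acyclicity of the cell complex *)

Section Signs.
Variable R : comNzRingType.

(* Levels are contiguous in this order: removing either of the two vertices
   that a cell of size r.+1 has on a common level yields opposite signs. *)
Definition before u v : bool :=
  (rk u < rk v)%N || (rk u == rk v) && (enum_rank u < enum_rank v)%N.

Lemma before_irr u : before u u = false.
Proof. by rewrite /before !ltnn andbF. Qed.

Lemma before_asym u v : u != v -> before u v = ~~ before v u.
Proof.
move=> uv; rewrite /before; case: (ltngtP (rk u) (rk v)) => //= _.
by case: ltngtP => // /val_inj/enum_rank_inj/eqP; rewrite (negPf uv).
Qed.

(** The simplicial sign: the parity of the position of [v] among the vertices of [s] listed by
    [before]. *)
Definition incidence v s : R := (-1) ^+ #|[set u in s | before u v]|.

Lemma incidence_sqr v s : incidence v s * incidence v s = 1.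
Proof. by rewrite -expr2 sqrr_sign. Qed.

Lemma incidenceU1 u v s : u \notin s ->
  incidence v (u |: s) = (-1) ^+ before u v * incidence v s.
Proof.
move=> us; rewrite -exprD; congr (_ ^+ _); case: (boolP (before u v)) => buv.
  rewrite (_ : [set w in u |: s | _] = u |: [set w in s | before w v]).
    by rewrite cardsU1 inE (negPf us).
  by apply/setP=> w; rewrite !inE; case: eqP => // ->; rewrite buv.
rewrite add0n; apply: eq_card => w; rewrite !inE.
by case: eqP => // ->; rewrite (negPf buv) (negPf us).
Qed.

Lemma incidence_self v s : v \notin s -> incidence v (v |: s) = incidence v s.
Proof. by move=> vs; rewrite incidenceU1 // before_irr mul1r. Qed.

(** Exactly one of [u] and [v] comes before the other, so inserting the other vertex flips exactly
    one of the two signs. *)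
Lemma incidence_swap u v s : u \notin s -> v \notin s -> u != v ->
  incidence u s * incidence v (u |: s) =
  - (incidence v s * incidence u (v |: s)).
Proof.
move=> us vs uv; rewrite !incidenceU1 // (before_asym uv) signrN.
by rewrite !(mulrC (incidence _ s)) !mulNr -!mulrA [incidence v s * _]mulrC.
Qed.

Definition supported n (c : {set T} -> R) (A : {set T}) : Prop :=
  forall s, c s != 0 -> [&& cell s, s \subset A & #|s| == n].

(** Chains are coefficient functions, so the boundary is read off at a face [s] from the cells
    [v |: s]. Sets that are not cells, such as faces missing a level, get 0. *)
Definition boundary (c : {set T} -> R) s : R :=
  if cell s then \sum_(v | v \notin s) incidence v s * c (v |: s) else 0.

Lemma boundary_neq0 c s : boundary c s != 0 ->
  cell s /\ exists2 v, v \notin s & c (v |: s) != 0.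
Proof.
rewrite /boundary; case: ifP; last by rewrite eqxx.
case: (boolP [exists v, (v \notin s) && (c (v |: s) != 0)]).
  by case/existsP=> v /andP[vs cv] _ _; split=> //; exists v.
rewrite negb_exists => /forallP nz _ /negP; case; apply/eqP.
apply: big1 => v vs; have := nz v; rewrite vs negbK => /eqP ->.
by rewrite mulr0.
Qed.

Lemma boundary_supported n c A :
  supported n.+1 c A -> supported n (boundary c) A.
Proof.
move=> sc s /boundary_neq0[cs [v vs /sc /and3P[_ sA]]].
rewrite cardsU1 vs eqSS cs => sn.
by rewrite (subset_trans (subsetUr _ _) sA) sn.
Qed.

Lemma boundary_boundary n c A s : supported n c A -> boundary (boundary c) s = 0.
Proof.
move=> sc; rewrite {1}/boundary; case: ifP => // cs.
(* [f u v] is the contribution of removing [v] first and [u] second; it is antisymmetric, so the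
   pairs cancel. *)
pose f u v := if (u \notin s) && (v \notin u |: s)
  then incidence u s * incidence v (u |: s) * c (v |: (u |: s)) else 0.
have fuv u v : f u v = - f v u.
  rewrite /f !inE !negb_or eq_sym; case: (eqVneq v u) => [->|vu] /=.
    by rewrite andbF oppr0.
  rewrite andbC; case: ifP => [/andP[vs us]|]; last by rewrite oppr0.
  by rewrite (@incidence_swap u v) 1?eq_sym // mulNr setUCA.
(* Antisymmetry alone would not give this in characteristic 2. *)
have fuu u : f u u = 0 by rewrite /f setU11 andbF.
transitivity (\sum_u \sum_v f u v).
  rewrite big_mkcond; apply: eq_bigr => u _; rewrite /f.
  case: ifP => us; last by rewrite big1.
  rewrite /boundary; case: ifP => cus.
    by rewrite big_distrr [RHS]big_mkcond /= big_mkcond; apply: eq_bigr => v _;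
      case: ifP; rewrite // mulrA.
  rewrite mulr0 big1 // => v _; case: ifP => //= _.
  have [->|/sc /and3P[cvus _ _]] := eqVneq (c (v |: (u |: s))) 0; first exact: mulr0.
  (* The intermediate face lies between two cells, hence is a cell and is not lost. *)
  by move: cus; rewrite (cell_between cs cvus) ?subsetUr.
rewrite pair_big /= (bigID (fun x => before x.1 x.2)) /=.
rewrite [X in _ + X](bigID (fun x => x.1 == x.2)) /=.
rewrite [X in _ + (X + _)]big1 ?add0r; last first.
  by move=> [u v] /= /andP[_ /eqP ->].
rewrite [X in _ + X](reindex_inj (h := fun x : T * T => (x.2, x.1))) /=; last first.
  by move=> [u v] [u' v'] [-> ->].
rewrite [X in _ + X](eq_bigl (fun x => before x.1 x.2)); last first.
  move=> [u v] /=; case: (eqVneq v u) => [->|vu]; first by rewrite before_irr.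
  by rewrite (before_asym vu) andbT negbK.
rewrite -big_split /= big1 // => -[u v] _ /=; by rewrite fuv addNr.
Qed.

(** A cell of size [r.+1] has exactly two vertices on a common level, and the only facets that are
    cells omit one of these two. Their signs are opposite. *)
Lemma sum_boundary c A : supported r.+1 c A -> \sum_s boundary c s = 0.
Proof.
move=> sc.
transitivity (\sum_(t : {set T})
    (\sum_(v | (v \in t) && cell (t :\ v)) incidence v t) * c t).
  transitivity (\sum_v \sum_(s : {set T} | (v \notin s) && cell s)
      incidence v s * c (v |: s)).
    rewrite (exchange_big_dep xpredT) //=; apply: eq_bigr => s _.
    by rewrite /boundary; case: ifP => cs; [apply: eq_bigl => v; rewrite andbT
      | rewrite big_pred0 // => v; rewrite andbF].
  under [RHS]eq_bigr do rewrite big_distrl /=.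
  rewrite [RHS](exchange_big_dep xpredT) //=; apply: eq_bigr => v _.
  rewrite (reindex_onto (fun t => t :\ v) (fun s => v |: s)) /=; last first.
    by move=> s /andP[vs _]; rewrite setU1K.
  apply: eq_big => [t|t].
    rewrite in_setD1 eqxx /= andbC; case: (boolP (v \in t)) => vt /=.
      by rewrite setD1K ?eqxx.
    by apply: contraNF vt => /andP[/eqP <- _]; rewrite setU11.
  move=> /andP[_ /eqP eq_t]; rewrite eq_t; congr (_ * _).
  by rewrite -[in RHS]eq_t incidence_self // setD11.
apply: big1 => t _; have [->|] := eqVneq (c t) 0; first exact: mulr0.
move=> /sc /and3P[ct _ /eqP card_t].
have ninj : ~ {in t &, injective rk}.
  by move=> /rank_inj_card; rewrite card_t ltnn.
have cardD1 w : w \in t -> #|t :\ w| = r.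
  by move=> wt; move: card_t; rewrite (cardsD1 w) wt => -[].
have [u [v [ut vt uv eq_rk]]] : exists u v, [/\ u \in t, v \in t, u != v & rk u = rk v].
  case: (boolP [exists u in t, exists v in t, (u != v) && (rk u == rk v)]).
    by case/exists_inP=> u ut /exists_inP[v vt /andP[? /eqP ?]]; exists u, v.
  move=> /exists_inPn none; case: ninj => p q pt qt rk_pq; apply/eqP.
  apply: contraT => pq; have /exists_inPn/(_ q qt) := none p pt.
  by rewrite pq rk_pq eqxx.
have cu : cell (t :\ u) by apply: (cell_remove ct ut vt).
have cv : cell (t :\ v) by apply: (cell_remove ct vt ut); rewrite // eq_sym.
have only w : w \in t -> cell (t :\ w) -> (w == u) || (w == v).
  move=> wt /cell_rank_inj/(_ (cardD1 w wt)) inj; apply: contraR uv.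
  rewrite negb_or => /andP[wu wv]; apply/eqP/inj => //; by rewrite !inE 1?eq_sym ?wu ?wv.
rewrite (bigD1 u) ?ut //= (bigD1 v) /= ?vt ?cv 1?eq_sym ?uv //= big_pred0; last first.
  move=> w; apply/negP=> /andP[/andP[/andP[wt cw] wu] wv].
  by have := only w wt cw; rewrite (negPf wu) (negPf wv).
set t0 := t :\ u :\ v; have ut0 : u \notin t0 by rewrite !inE eqxx andbF.
have vt0 : v \notin t0 by rewrite !inE eqxx.
have tE : t = u |: (v |: t0) by rewrite /t0 setD1K ?setD1K // !inE eq_sym uv.
have vt1 : v \notin u |: t0 by rewrite !inE eq_sym (negPf uv) eqxx.
have ut1 : u \notin v |: t0 by rewrite !inE (negPf uv) eqxx andbF.
(* Every other vertex lies on a different level, where [before] does not distinguish [u] from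
   [v]. *)
have bE w : w \in t0 -> before w u = before w v.
  rewrite !inE => /and3P[wv wu wt].
  have inju := cell_rank_inj cu (cardD1 u ut).
  suff rwv : rk w != rk v by rewrite /before eq_rk (negPf rwv).
  by apply: contra_neq wv => eq_w; apply: inju => //; rewrite !inE ?wu //= eq_sym uv.
have s0 : incidence u t0 = incidence v t0.
  rewrite /incidence; congr (_ ^+ _); apply: eq_card => w.
  by rewrite !(inE, in_set) -!in_setD1 -/t0; case: (boolP (w \in t0)) => // /bE ->.
have iu : incidence u t = incidence u (v |: t0) by rewrite tE incidence_self.
have iv : incidence v t = incidence v (u |: t0).
  by rewrite tE setUCA incidence_self.
rewrite iu iv !incidenceU1 // s0 (before_asym uv) signrN addr0.
by rewrite mulNr addrN mul0r.
Qed.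

Lemma boundaryD c c' s :
  boundary (fun t => c t + c' t) s = boundary c s + boundary c' s.
Proof.
rewrite /boundary; case: ifP => _; last by rewrite addr0.
by rewrite -big_split; apply: eq_bigr => v _; rewrite mulrDr.
Qed.

Lemma boundaryB c c' s :
  boundary (fun t => c t - c' t) s = boundary c s - boundary c' s.
Proof.
rewrite /boundary; case: ifP => _; last by rewrite subr0.
by rewrite -sumrB; apply: eq_bigr => v _; rewrite mulrBr.
Qed.

Lemma boundary_zero s : boundary (fun=> 0) s = 0.
Proof. by rewrite /boundary; case: ifP => // _; apply: big1 => v; rewrite mulr0. Qed.

(** The contracting homotopy with apex [g]; cells of [c] that already contain [g] contribute
    nothing. *)
Definition cone g (c : {set T} -> R) s : R :=
  if g \in s then incidence g (s :\ g) * c (s :\ g) else 0.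

Lemma boundary_cone_notin g c s : cell s -> g \notin s ->
  boundary (cone g c) s = c s.
Proof.
move=> cs gs; rewrite /boundary cs (bigD1 g) //= big1 => [|v /andP[vs vg]].
  by rewrite /cone setU11 setU1K // mulrA incidence_sqr mul1r addr0.
by rewrite /cone !inE eq_sym (negPf vg) (negPf gs) mulr0.
Qed.

(** The cycle condition at [s :\ g] expresses [c s] through the other cofaces of [s :\ g]; by
    [incidence_swap] the boundary of the cone is the same sum. *)
Lemma boundary_cone_in g c s : cell s -> g \in s -> cell (s :\ g) ->
  boundary c (s :\ g) = 0 -> boundary (cone g c) s = c s.
Proof.
set t := s :\ g => cs gs ct; have gt : g \notin t by rewrite setD11.
have sE : s = g |: t by rewrite setD1K.
rewrite /boundary cs ct (bigD1 g) //= -sE => /eqP.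
rewrite addr_eq0 => /eqP bt.
transitivity (incidence g t * (incidence g t * c s)); last first.
  by rewrite mulrA incidence_sqr mul1r.
rewrite bt mulrN mulr_sumr -sumrN; apply: eq_big => [v|v vs].
  by rewrite sE !inE negb_or andbC.
have [vg vt] : v != g /\ v \notin t by move: vs; rewrite sE !inE negb_or => /andP[].
rewrite /cone !inE gs orbT (_ : (v |: s) :\ g = v |: t); last first.
  apply/setP=> w; rewrite !inE; case: (eqVneq w v) => [->|] //=; by rewrite vg.
rewrite sE !mulrA -mulNr; congr (_ * _).
rewrite -[LHS]mul1r -[in LHS](incidence_sqr g t) !mulrA -[_ * _ * incidence v _]mulrA.
rewrite incidence_swap // 1?eq_sym // mulrN !mulNr -!mulrA incidence_sqr.
by rewrite mulr1.
Qed.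

Hypothesis nested : forall p p', rk p = rk p' ->
  (forall q, rk p = (rk q).+1 -> e q p -> e q p') \/
  (forall q, rk p = (rk q).+1 -> e q p' -> e q p).

(** Lower neighbourhoods on one level are nested, so one of maximal size contains all the others. *)
Lemma exists_dominating (K : {set T}) j p0 :
  p0 \in K -> {in K, forall p, rk p = j} ->
  exists2 g, g \in K &
    forall p q, p \in K -> j = (rk q).+1 -> e q p -> e q g.
Proof.
move=> p0K rkK; pose dn p := [set q | (j == (rk q).+1) && e q p].
case: (arg_maxnP (fun p => #|dn p|) p0K) => g gK gmax.
exists g => // p q pK rkq eqp.
have [||sub] := @nested p g; first by rewrite !rkK.
  by apply=> //; rewrite rkK.
have subset_gp : dn g \subset dn p.
  apply/subsetP=> w; rewrite !inE => /andP[/eqP rkw ewg].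
  by rewrite rkw eqxx /= sub // rkK.
have /eqP eq_gp : dn g == dn p by rewrite eqEcard subset_gp; apply: gmax.
have : q \in dn g by rewrite eq_gp inE rkq eqxx.
by rewrite inE => /andP[].
Qed.

(** Invariant of the collapse: all cells of [c] have the same trace [U] above level [j], with one
    vertex per level. Subtracting the boundary of a cone over a dominating vertex of the next level
    down extends the trace by that vertex. At [j = 0] only the cell [U] is left, and the sum
    condition makes its coefficient vanish. *)
Lemma acyclic_above j (U : {set T}) n c A : (j <= r)%N ->
  supported n c A -> (forall s, c s != 0 -> [set p in s | (j < rk p)%N] = U) ->
  {in U &, injective rk} -> #|U| = (r - j)%N ->
  (forall s, boundary c s = 0) -> (n = r -> \sum_s c s = 0) ->
  exists2 z, supported n.+1 z A & forall s, c s = boundary z s.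
Proof.
elim: j U c => [|j IHj] U c jr sc cU injU cardU bc sumc.
  exists (fun=> 0) => [s|s]; first by rewrite eqxx.
  rewrite boundary_zero; apply/eqP; apply: contraT => cs0.
  have sU t : c t != 0 -> t = U.
    by move=> /cU <-; apply/setP=> p; rewrite !inE;
      have /andP[->] := rk_bound p; rewrite andbT.
  have sE := sU s cs0; have /and3P[_ _ /eqP sn] := sc s cs0.
  have nr : n = r by rewrite -sn sE cardU subn0.
  have := sumc nr; rewrite (bigD1 s) //= big1 => [|t ts].
    by move/eqP; rewrite addr0 (negPf cs0).
  by apply/eqP; apply: contraNT ts => /sU ->; rewrite sE.
case: (boolP [exists s, c s != 0]) => [/existsP[s0 cs0]|]; last first.
  rewrite negb_exists => /forallP c0; exists (fun=> 0) => [s|s].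
    by rewrite eqxx.
  by have := c0 s; rewrite negbK => /eqP ->; rewrite boundary_zero.
(* The candidates for the next vertex: every cell in [A] with trace [U] has its vertices of level
   [j.+1] in [K]. *)
pose K := [set p in A | (rk p == j.+1) &&
                     [forall q in U, (rk q == j.+2) ==> e p q]].
have memK s p : cell s -> s \subset A -> [set q in s | (j.+1 < rk q)%N] = U ->
    p \in s -> rk p = j.+1 -> p \in K.
  move=> /cellP[_ edge] /subsetP sA sU ps rkp; rewrite inE sA // rkp eqxx.
  apply/forall_inP=> q; rewrite -sU inE => /andP[qs _]; apply/implyP=> /eqP rkq.
  by apply: edge; rewrite // rkp.
have [g gK gmax] : exists2 g, g \in K &
    forall p q, p \in K -> j.+1 = (rk q).+1 -> e q p -> e q g.
  have /and3P[cell0 s0A _] := sc s0 cs0; have /cellP[meet _] := cell0.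
  have [|p ps rkp] := meet j.+1; first by rewrite jr.
  apply: (exists_dominating (p0 := p)); first by apply: (memK s0) => //; apply: cU.
  by move=> q; rewrite inE => /and3P[_ /eqP].
have [gA rkg gU] : [/\ g \in A, rk g = j.+1 &
    forall q, q \in U -> rk q = j.+2 -> e g q].
  move: gK; rewrite inE => /and3P[? /eqP ? /forall_inP gU]; split=> // q qU rkq.
  by have := gU q qU; rewrite rkq eqxx.
(* Upwards [g] is joined to [U] as an element of [K]; downwards it dominates a vertex of [s] on its
   own level. *)
have cell_g s : cell s -> s \subset A ->
    [set q in s | (j.+1 < rk q)%N] = U -> cell (g |: s).
  move=> cs sA sU; have /cellP[meet edge] := cs; apply/cellP; split.
    by move=> i /meet[p ps <-]; exists p; rewrite // setU1r.
  move=> p q /setU1P[->|ps] /setU1P[->|qs] rkpq.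
  - by move: rkpq => /n_Sn.
  - by apply: gU; rewrite -?sU ?inE ?qs ?rkpq rkg //=.
  - have [|w ws rkw] := meet j.+1; first by rewrite jr.
    apply: (gmax w) => //; first exact: (memK s).
      by rewrite -rkg rkpq.
    by apply: edge; rewrite // rkw -rkg.
  - exact: edge.
pose z := cone g c; pose c' s := c s - boundary z s.
have sz : supported n.+1 z A.
  move=> s; rewrite /z /cone; case: ifP => gs; last by rewrite eqxx.
  have [->|ct0 _] := eqVneq (c (s :\ g)) 0; first by rewrite mulr0 eqxx.
  have /and3P[ct tA /eqP tn] := sc _ ct0.
  have := cell_g _ ct tA (cU _ ct0); rewrite setD1K // => ->.
  by rewrite (cardsD1 g) gs tn add1n eqxx -(setD1K gs) subUset sub1set gA tA.
have c'E s : c' s != 0 -> (c s != 0) \/ (boundary z s != 0).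
  by rewrite /c'; have [->|] := eqVneq (c s) 0; [rewrite sub0r oppr_eq0; right | left].
have sc' : supported n c' A.
  by move=> s /c'E[/sc //|]; apply: boundary_supported.
have c'U s : c' s != 0 -> [set p in s | (j.+1 < rk p)%N] = U.
  case/c'E=> [/cU //|/boundary_neq0[cs [v vs]]].
  rewrite /z /cone; case: ifP => gs; last by rewrite eqxx.
  have [->|/cU tU _] := eqVneq (c ((v |: s) :\ g)) 0; first by rewrite mulr0 eqxx.
  have memU w : (w \in U) = (w \in v |: s) && (j.+1 < rk w)%N.
    by rewrite -tU inE in_setD1; have [->|//] := eqVneq w g; rewrite rkg ltnn !andbF.
  apply/setP=> w; rewrite memU !inE; case: (eqVneq w v) => [->|//] /=.
  (* Removing [v] above level [j.+1] is impossible: the cell [s] has a second vertex on that level,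
     and both would lie in [U]. *)
  rewrite (negPf vs) /=; apply/esym/negP => rkv.
  have /cellP[/(_ (rk v) (rk_bound v))[p ps rkp] _] := cs.
  have: p = v by apply: injU; rewrite // memU ?rkp ?rkv !inE ?eqxx ?ps ?orbT.
  by move=> pv; rewrite -pv ps in vs.
(* On a cell with a vertex [p != g] of level [j.+1] the cone reproduces [c]: if [g] is in [s], then
   [p] keeps [s :\ g] a cell. *)
have c'g s p : c' s != 0 -> p \in s -> rk p = j.+1 -> p = g.
  move=> cs' ps rkp; apply/eqP; move: cs'; apply: contraTT => pg.
  have [/and3P[cs _ _]|] := boolP [&& cell s, s \subset A & #|s| == n]; last first.
    by move/negP=> nc; rewrite negbK; apply: contraT => /sc'/nc.
  rewrite negbK subr_eq0; apply/eqP/esym.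
  case: (boolP (g \in s)) => gs; last exact: boundary_cone_notin.
  apply: boundary_cone_in => //; apply: (cell_remove cs gs ps); rewrite ?rkg ?rkp //.
  by rewrite eq_sym.
have gNU : g \notin U.
  by apply/negP; rewrite -(cU s0 cs0) inE rkg ltnn andbF.
have rkU w : w \in U -> (j.+1 < rk w)%N by rewrite -(cU s0 cs0) inE => /andP[].
have [|||||z' sz' z'E] := IHj (g |: U) c' (ltnW jr) sc'.
- move=> s cs'; have cU' := c'U s cs'.
  apply/setP=> w; rewrite !inE -cU' inE leq_eqVlt andb_orr; congr (_ || _).
  apply/andP/eqP=> [[ws /eqP rkw]|->]; first by apply: (c'g s).
  have /and3P[/cellP[meet _] _ _] := sc' s cs'.
  have [|p ps rkp] := meet j.+1; first by rewrite jr.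
  by rewrite -(c'g s p) // rkp eqxx.
- move=> p q /setU1P[->|pU] /setU1P[->|qU] //.
  + by move=> eq_rk; have := rkU q qU; rewrite -eq_rk rkg ltnn.
  + by move=> eq_rk; have := rkU p pU; rewrite eq_rk rkg ltnn.
  + exact: injU.
- by rewrite cardsU1 gNU cardU add1n subnSK.
- by move=> s; rewrite boundaryB bc (boundary_boundary _ sz) subr0.
- move=> nr; rewrite sumrB sumc // (sum_boundary (A := A)) ?subr0 //.
  by rewrite -nr.
exists (fun s => z s + z' s) => [s|s]; last first.
  by rewrite boundaryD -z'E /c' addrC subrK.
by have [->|/sz //] := eqVneq (z s) 0; rewrite add0r => /sz'.
Qed.

Lemma acyclic n c A : supported n c A -> (forall s, boundary c s = 0) ->
  (n = r -> \sum_s c s = 0) ->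
  exists2 z, supported n.+1 z A & forall s, c s = boundary z s.
Proof.
move=> sc bc sumc; apply: (@acyclic_above r set0) => //.
- move=> s _; apply/setP=> p; rewrite !inE ltnNge.
  by have /andP[_ ->] := rk_bound p; rewrite andbF.
- by move=> p q; rewrite inE.
- by rewrite cards0 subnn.
Qed.

End Signs.
End CellComplex.

(** * Squarefree monomials of vertex sets *)

Section SetMonomials.
Variables (T : finType) (k : fieldType).
Implicit Types (s t A : {set T}) (b : 'X_{1..#|T|}).

Definition set_mnm s : 'X_{1..#|T|} := [multinom (enum_val i \in s : nat) | i < #|T|].

Lemma set_mnmE s p : set_mnm s (enum_rank p) = (p \in s).
Proof. by rewrite mnmE enum_rankK. Qed.

Lemma mdeg_set_mnm s : mdeg (set_mnm s) = #|s|.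
Proof.
rewrite mdegE -sum1_card [RHS]big_mkcond [LHS](reindex enum_rank) /=; last first.
  by apply: onW_bij; apply: enum_rank_bij.
by apply: eq_bigr => p _; rewrite set_mnmE; case: ifP.
Qed.

Lemma set_mnmU1 s p : p \notin s -> set_mnm (p |: s) = (U_(enum_rank p) + set_mnm s)%MM.
Proof.
move=> ps; apply/mnmP=> i; rewrite mnmDE mnm1E !mnmE !inE.
rewrite -(inj_eq enum_val_inj) enum_rankK eq_sym.
by case: eqP => // <-; rewrite (negPf ps).
Qed.

Lemma set_mnm_le s b :
  (set_mnm s <= b)%MM = (s \subset [set p | b (enum_rank p) != 0%N]).
Proof.
apply/mnm_lepP/subsetP=> [le p ps | sb i].
  by rewrite inE -lt0n; have := le (enum_rank p); rewrite set_mnmE ps.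
rewrite mnmE; case: (boolP (enum_val i \in s)) => // /sb.
by rewrite inE enum_valK lt0n.
Qed.

Lemma prod_set_mnm s : \prod_(p in s) 'X_(enum_rank p) = 'X_[k, set_mnm s].
Proof.
have [n] := ubnP #|s|; elim: n s => // n IHn s lt_sn.
have [->|[p ps]] := set_0Vmem s.
  rewrite big_set0 -mpolyX0; congr ('X_[_]); apply/mnmP=> i.
  by rewrite mnm0E mnmE inE.
rewrite (big_setD1 p ps) /= IHn; last by move: lt_sn; rewrite (cardsD1 p) ps.
by rewrite -{2}(setD1K ps) set_mnmU1 ?setD11 // mpolyXD.
Qed.

Lemma mcoeffMX_neq0 (f : {mpoly k[#|T|]}) b m : (f * 'X_[m])@_b != 0 -> (m <= b)%MM.
Proof.
rewrite -mcoeff_msupp (perm_mem (msuppMX f m)) => /mapP[m' _ ->].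
exact: lem_addr.
Qed.

End SetMonomials.

(** * The cell complex with polynomial coefficients *)

Section WeightedComplex.
Variables (T : finType) (e : rel T) (rk : T -> nat) (r : nat) (k : fieldType).
Local Notation S := {mpoly k[#|T|]}.
Implicit Types (s t : {set T}) (w z : {set T} -> S).
Local Notation cell := (cell e rk r).
Local Notation bdry := (boundary e rk r).
Local Notation supported := (supported e rk r).
Local Notation sX s := 'X_[k, set_mnm s].

(** The cellular differential: the variable of [v] is the quotient of the monomials of [v |: t] and
    [t]. *)
Definition wboundary w t : S :=
  if cell t then
    \sum_(v | v \notin t) incidence rk S v t * ('X_(enum_rank v) * w (v |: t))
  else 0.

Lemma incidence_scale v t (a : k) (f : S) :
  (incidence rk k v t * a) *: f = incidence rk S v t * (a *: f).
Proof. by rewrite /incidence -scalerA -!(signr_odd _ #|_|) scaler_sign mulr_sign. Qed.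

(** Scaling every coefficient by the monomial of its cell removes the weights. The scaling is
    injective, so identities transfer from the unweighted boundary. *)
Lemma wboundary_mul w t :
  wboundary w t * sX t = bdry (fun s => w s * sX s) t.
Proof.
rewrite /wboundary /boundary; case: ifP => _; last exact: mul0r.
rewrite mulr_suml; apply: eq_bigr => v vt.
rewrite set_mnmU1 // mpolyXD -!mulrA; congr (_ * _).
by rewrite mulrCA.
Qed.

Lemma mpolyX_neq0 (m : 'X_{1..#|T|}) : 'X_[k, m] != 0.
Proof. by rewrite -msupp_eq0 msuppX. Qed.

Lemma mulX_inj t : injective (fun f : S => f * sX t).
Proof. by move=> f g; apply: mulIf; apply: mpolyX_neq0. Qed.

Lemma wboundary_eq0 w : (forall t, wboundary w t = 0) <->
  (forall t, bdry (fun s => w s * sX s) t = 0).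
Proof.
split=> h t; first by rewrite -wboundary_mul h mul0r.
by apply: (@mulX_inj t); rewrite wboundary_mul h mul0r.
Qed.

Lemma supported_mulX n w A : supported n w A <-> supported n (fun s => w s * sX s) A.
Proof.
by split=> h s; have := h s; rewrite mulf_eq0 negb_or mpolyX_neq0 andbT.
Qed.

Lemma wboundary_supported n w : supported n.+1 w setT -> supported n (wboundary w) setT.
Proof.
move=> /supported_mulX/boundary_supported sw; apply/supported_mulX=> s.
by rewrite wboundary_mul; apply: sw.
Qed.

Lemma wboundary_wboundary n w t : supported n w setT -> wboundary (wboundary w) t = 0.
Proof.
move=> /supported_mulX sw; apply: (@mulX_inj t).
rewrite wboundary_mul mul0r -[RHS](boundary_boundary t sw).
by rewrite /boundary; case: ifP => // _; apply: eq_bigr => v _; rewrite wboundary_mul.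
Qed.

Hypothesis rk_bound : forall p, (0 < rk p <= r)%N.

Lemma sum_wboundary w : supported r.+1 w setT -> \sum_s wboundary w s * sX s = 0.
Proof.
move=> /supported_mulX sw; rewrite -[RHS](sum_boundary rk_bound sw).
by apply: eq_bigr => s _; rewrite wboundary_mul.
Qed.

Hypothesis nested : forall p p', rk p = rk p' ->
  (forall q, rk p = (rk q).+1 -> e q p -> e q p') \/
  (forall q, rk p = (rk q).+1 -> e q p' -> e q p).

Lemma mcoeff_boundary w t b :
  (bdry w t)@_b = bdry (fun s => (w s)@_b) t.
Proof.
rewrite /boundary; case: ifP => _; last exact: mcoeff0.
by rewrite raddf_sum; apply: eq_bigr => v _; rewrite /incidence /= raddfMsign.
Qed.

(* The strand of multidegree [b] is the cell complex of the support of [b]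
   over [k]. *)
Lemma wacyclic n w : supported n w setT -> (forall t, wboundary w t = 0) ->
  (n = r -> \sum_s w s * sX s = 0) ->
  exists2 z, supported n.+1 z setT & forall s, w s = wboundary z s.
Proof.
move=> sw /wboundary_eq0 bw sumw.
(* All monomials that occur have degree below [D], so finitely many multidegrees have to be
   treated. *)
pose D := (\max_s msize (w s * sX s))%N.
pose A (b : 'X_{1..#|T| < D}) := [set p | b (enum_rank p) != 0%N].
have [zz zzP] : exists zz : 'X_{1..#|T| < D} -> {set T} -> k, forall b,
    supported n.+1 (zz b) (A b) /\
    forall s, (w s * sX s)@_b = bdry (zz b) s.
  apply: (@fin_all_exists _ _ (fun b (z : {set T} -> k) => supported n.+1 z (A b) /\
    forall s, (w s * sX s)@_b = bdry z s)) => b.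
  have [|||z sz zE] := acyclic rk_bound nested (n := n) (A := A b)
      (c := fun s => (w s * sX s)@_b).
  - move=> s ws0; rewrite -set_mnm_le (mcoeffMX_neq0 ws0).
    have w0 : w s != 0 by apply: contraNneq ws0 => ->; rewrite mul0r mcoeff0.
    by have /and3P[-> _ ->] := sw s w0.
  - by move=> t; rewrite -mcoeff_boundary bw mcoeff0.
  - by move=> /sumw /(congr1 (mcoeff b)); rewrite raddf_sum /= mcoeff0.
  by exists z.
(* The subtraction of exponents is exact wherever [zz b s] is nonzero, since [s] then lies in the
   support of [b]. *)
pose z s := \sum_b zz b s *: 'X_[k, b - set_mnm s].
have zX s : z s * sX s = \sum_b zz b s *: 'X_[bmnm b].
  rewrite mulr_suml; apply: eq_bigr => b _; have [->|zb0] := eqVneq (zz b s) 0.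
    by rewrite !scale0r mul0r.
  have /and3P[_ sA _] := (zzP b).1 s zb0.
  by rewrite -scalerAl -mpolyXD submK // set_mnm_le.
exists z => s.
  case: (boolP [exists b, zz b s != 0]) => [/existsP[b /((zzP b).1 s)]|].
    by rewrite subsetT => /and3P[-> _ ->].
  rewrite negb_exists => /forallP z0; rewrite /z big1 ?eqxx // => b _.
  by have := z0 b; rewrite negbK => /eqP ->; rewrite scale0r.
apply: (@mulX_inj s); rewrite wboundary_mul [LHS](mpolywE (k := D)); last first.
  exact: (leq_bigmax s).
under eq_bigr do rewrite (zzP _).2.
rewrite /boundary; case: ifP => cs; last by rewrite big1 // => b _; rewrite scale0r.
under eq_bigr do rewrite scaler_suml.
rewrite exchange_big; apply: eq_bigr => v vs; rewrite zX mulr_sumr.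
by apply: eq_bigr => b _; rewrite incidence_scale.
Qed.

End WeightedComplex.

(** * The cell resolution *)

Section CellResolution.
Variables (T : finType) (e : rel T) (rk : T -> nat) (r : nat) (k : fieldType).
Local Notation S := {mpoly k[#|T|]}.
Implicit Types (s t : {set T}) (w : {set T} -> S).
Local Notation cell := (cell e rk r).
Local Notation supported := (supported e rk r).
Local Notation wbdry := (wboundary e rk r).
Local Notation sX s := 'X_[k, set_mnm s].

Definition cells i : {set {set T}} := [set s | cell s && (#|s| == r + i)%N].

(** Extends a row by zero to all sets; the sum has at most one term. *)
Definition cell_coef i (a : 'rV[S]_#|cells i|) s : S :=
  \sum_(u | enum_val u == s) a ord0 u.

Definition cell_row i w : 'rV[S]_#|cells i| := \row_u w (enum_val u).

Lemma cell_coef_val i (a : 'rV[S]_#|cells i|) u : cell_coef a (enum_val u) = a ord0 u.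
Proof. by rewrite /cell_coef (big_pred1 u) // => v; rewrite (inj_eq enum_val_inj). Qed.

Lemma cell_coef_supported i (a : 'rV[S]_#|cells i|) :
  supported (r + i)%N (cell_coef a) setT.
Proof.
move=> s; rewrite /cell_coef; case: (boolP [exists u : 'I_#|cells i|, enum_val u == s]).
  by case/existsP=> u /eqP <- _; have := enum_valP u; rewrite inE subsetT.
by rewrite negb_exists => /forallP none; rewrite big_pred0 ?eqxx // => u; apply/negbTE.
Qed.

Lemma cell_coef_row i w s : supported (r + i)%N w setT ->
  cell_coef (cell_row i w) s = w s.
Proof.
move=> sw; have [cs|ncs] := boolP (s \in cells i).
  by rewrite -(enum_rankK_in cs cs) cell_coef_val mxE.
have zero f : supported (r + i)%N f setT -> f s = 0.
  move=> sf; apply/eqP; apply: contraNT ncs => /sf/and3P[cs _ card_s].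
  by rewrite inE cs.
by rewrite !zero //; apply: cell_coef_supported.
Qed.

Definition cell_shift i (u : 'I_#|cells i|) : nat := (r + i)%N.

Definition cell_aug : 'cV[S]_#|cells 0| := \col_u sX (enum_val u).

(** At most one [p] contributes, the vertex by which the two cells differ; the sum avoids choosing
    it. *)
Definition cell_diff i : 'M[S]_(#|cells i.+1|, #|cells i|) :=
  \matrix_(u < #|cells i.+1|, v < #|cells i|)
    \sum_(p | (p \notin enum_val v) && (p |: enum_val v == enum_val u))
 
    incidence rk S p (enum_val v) * 'X_(enum_rank p).

Lemma cell_augE (a : 'rV[S]_#|cells 0|) :
  (a *m cell_aug) ord0 ord0 = \sum_s cell_coef a s * sX s.
Proof.
rewrite mxE (partition_big enum_val xpredT) //=; apply: eq_bigr => s _.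
by rewrite /cell_coef mulr_suml; apply: eq_bigr => u /eqP us; rewrite mxE us.
Qed.

Lemma cell_diffE i (a : 'rV[S]_#|cells i.+1|) :
  a *m cell_diff i = cell_row i (wbdry (cell_coef a)).
Proof.
apply/rowP=> v; rewrite !mxE /wboundary.
have := enum_valP v; rewrite inE => /andP[-> _].
transitivity (\sum_u \sum_(p | (p \notin enum_val v) && (p |: enum_val v == enum_val u))
    incidence rk S p (enum_val v) * ('X_(enum_rank p) * a ord0 u)).
  apply: eq_bigr => u _; rewrite mxE mulr_sumr; apply: eq_bigr => p _.
  by rewrite mulrC mulrA.
rewrite (exchange_big_dep (fun p => p \notin enum_val v)) /=; last first.
  by move=> u p _ /andP[].
apply: eq_bigr => p pv; rewrite /cell_coef !mulr_sumr; apply: eq_bigl => u.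
by rewrite pv eq_sym.
Qed.

Lemma cell_coef_diff i (a : 'rV[S]_#|cells i.+1|) s :
  cell_coef (a *m cell_diff i) s = wbdry (cell_coef a) s.
Proof.
rewrite cell_diffE cell_coef_row //; apply: wboundary_supported.
by rewrite -addnS; apply: cell_coef_supported.
Qed.

Lemma cell_coef_inj i (a b : 'rV[S]_#|cells i|) : cell_coef a =1 cell_coef b -> a = b.
Proof. by move=> ab; apply/rowP=> u; rewrite -!cell_coef_val. Qed.

Lemma cell_coef0 i s : cell_coef (0 : 'rV[S]_#|cells i|) s = 0.
Proof. by rewrite /cell_coef big1 // => u _; rewrite mxE. Qed.

Lemma cell_aug_homog u : cell_aug u ord0 \is (cell_shift u).-homog.
Proof.
rewrite mxE dhomogX; have := enum_valP u.
by rewrite inE -mdeg_set_mnm => /andP[].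
Qed.

Lemma cell_diff_linear i u v : cell_diff i u v \is 1.-homog.
Proof.
rewrite mxE; apply: rpred_sum => p _; rewrite /incidence -signr_odd mulr_sign.
have X1 : 'X_(enum_rank p) \is @ishomog1 #|T| k 1 mdeg.
  by rewrite dhomogX; apply/eqP/mdeg1.
by case: (odd _); rewrite ?rpredN.
Qed.

Lemma cell_diff_homog i (u : 'I_#|cells i.+1|) (v : 'I_#|cells i|) :
  if (cell_shift v <= cell_shift u)%N
  then cell_diff i u v \is (cell_shift u - cell_shift v)%N.-homog
  else cell_diff i u v == 0.
Proof.
rewrite /cell_shift leq_add2l leqnSn subnDl subSnn.
exact: cell_diff_linear.
Qed.

Hypothesis rk_bound : forall p, (0 < rk p <= r)%N.
Hypothesis nested : forall p p', rk p = rk p' ->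
  (forall q, rk p = (rk q).+1 -> e q p -> e q p') \/
  (forall q, rk p = (rk q).+1 -> e q p' -> e q p).

(** Serves both kinds of exactness: [r + i = r] singles out [i = 0], where the augmentation
    enters. *)
Lemma cell_exact i (a : 'rV[S]_#|cells i|) :
  (forall t, wbdry (cell_coef a) t = 0) ->
  ((r + i = r)%N -> \sum_s cell_coef a s * sX s = 0) ->
  exists z, a = z *m cell_diff i.
Proof.
move=> ba suma.
have [z sz az] := wacyclic rk_bound nested (@cell_coef_supported _ a) ba suma.
rewrite -addnS in sz; exists (cell_row i.+1 z); rewrite cell_diffE.
apply/rowP=> u; rewrite mxE -cell_coef_val az /wboundary.
by case: ifP => // _; apply: eq_bigr => v _; rewrite cell_coef_row.
Qed.

Lemma cell_exact_diff i (a : 'rV[S]_#|cells i.+1|) :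
  a *m cell_diff i = 0 <-> exists z, a = z *m cell_diff i.+1.
Proof.
split=> [a0|[z ->]].
  apply: cell_exact => [t|/eqP]; first by rewrite -cell_coef_diff a0 cell_coef0.
  by rewrite -[X in _ == X]addn0 eqn_add2l.
apply: cell_coef_inj => s; rewrite cell_coef_diff cell_coef0.
rewrite -[RHS](wboundary_wboundary s (@cell_coef_supported _ z)).
by rewrite /wboundary; case: ifP => // _; apply: eq_bigr => v _; rewrite cell_coef_diff.
Qed.

Lemma cell_exact_aug (a : 'rV[S]_#|cells 0|) :
  a *m cell_aug = 0 <-> exists z, a = z *m cell_diff 0.
Proof.
split=> [a0|[z ->]].
  have suma : \sum_s cell_coef a s * sX s = 0 by rewrite -cell_augE a0 mxE.
  apply: cell_exact => // t; rewrite /wboundary; case: ifP => // ct.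
  (* The boundary vanishes for lack of faces: if [v |: t] has size [r], then [t] is too small to be
     a cell. *)
  apply: big1 => v vt; have [->|] := eqVneq (cell_coef a (v |: t)) 0.
    by rewrite !mulr0.
  move=> /(@cell_coef_supported 0)/and3P[_ _]; rewrite addn0 cardsU1 vt.
  by have := cell_card ct; rewrite add1n => le /eqP tr;
    rewrite -[X in (X <= _)%N]tr ltnn in le.
apply/rowP=> i; rewrite ord1 cell_augE mxE.
under eq_bigr do rewrite cell_coef_diff.
apply: (sum_wboundary rk_bound).
by have := @cell_coef_supported 1 z; rewrite addn1.
Qed.

Variable I : S -> Prop.
Hypothesis IE : forall f, I f <->
  exists c : {set T} -> S, f = \sum_(s | cell s && (#|s| == r)) c s * sX s.

Lemma cell_image_aug f : I f <->
  exists a : 'rV[S]_#|cells 0|, f = (a *m cell_aug) ord0 ord0.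
Proof.
rewrite IE; split=> [[c ->]|[a ->]].
  exists (cell_row 0 (fun s => if cell s && (#|s| == r) then c s else 0)).
  rewrite cell_augE big_mkcond; apply: eq_bigr => s _.
  rewrite cell_coef_row; first by case: ifP; rewrite // mul0r.
  by move=> t; rewrite addn0 subsetT; case: ifP; rewrite ?eqxx.
exists (cell_coef a); rewrite cell_augE [RHS]big_mkcond; apply: eq_bigr => s _.
case: ifP => // ncs; have [->|] := eqVneq (cell_coef a s) 0; first by rewrite mul0r.
by move/(@cell_coef_supported 0); rewrite addn0 subsetT ncs.
Qed.

Definition cell_resolution : graded_free_resolution I :=
  GradedFreeResolution cell_aug_homog cell_diff_homog cell_image_aug
    cell_exact_aug cell_exact_diff.

Lemma cell_resolution_linear : has_linear_resolution I.
Proof.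
exists cell_resolution; last by exists r.
(* Minimality: a form of degree 1 has no constant term. *)
move=> i u v; apply: (dhomog_nemf_coeff (cell_diff_linear u v)).
by rewrite /= mdeg0.
Qed.

End CellResolution.

(** * Graded posets and their maximal chains *)

Section GradedPoset.
Variables (d : Order.disp_t) (P : finPOrderType d) (rk : P -> nat).
Hypothesis rkP : rank_function rk.
Local Notation r := (poset_rank rk).
Local Notation cell := (cell <%O rk r).
Implicit Types (p q : P) (C : {set P}).

Lemma coversP p q : (p < q)%O -> (forall z, (p < z)%O -> ~~ (z < q)%O) -> covers p q.
Proof.
move=> pq none; rewrite /covers /covers_in !inE pq /=.
by apply/forall_inP=> z _; apply/negP=> /andP[/none/negP].
Qed.

(** Among the elements of the half-open interval from [p] to [q], one with the most elements below
    it is covered by [q]. *)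
Lemma lower_cover p q : (p < q)%O -> exists2 z, (p <= z)%O & covers z q.
Proof.
move=> pq; pose K z := (p <= z)%O && (z < q)%O.
have Kp : K p by rewrite /K lexx.
case: (arg_maxnP (fun z => #|[set w | (w < z)%O]|) Kp) => z /andP[pz zq] zmax.
exists z => //; apply: coversP => // w zw; apply/negP=> wq.
have /zmax : K w by rewrite /K (le_trans pz) // ltW.
apply/negP; rewrite -ltnNge; apply/proper_card/properP; split.
  by apply/subsetP=> u; rewrite !inE => /lt_trans; apply.
by exists z; rewrite !inE // ltxx.
Qed.

Lemma rk_lt p q : (p < q)%O -> (rk p < rk q)%N.
Proof.
have [n] := ubnP #|[set w | (w < q)%O]|; elim: n q => // n IHn q lt_n pq.
have [z pz zq] := lower_cover pq; rewrite (rkP.2 _ _ zq) ltnS.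
have [-> //|pz'] := eqVneq p z; apply/ltnW/IHn; last by rewrite lt_neqAle pz'.
have /and4P[_ _ lt_zq _] := zq.
rewrite -ltnS; apply: leq_trans lt_n; rewrite ltnS; apply/proper_card/properP; split.
  by apply/subsetP=> u; rewrite !inE => /lt_trans; apply.
by exists z; rewrite !inE // ltxx.
Qed.

Lemma rk_le p q : (p <= q)%O -> (rk p <= rk q)%N.
Proof. by rewrite le_eqVlt => /predU1P[-> //|/rk_lt/ltnW]. Qed.

Lemma exists_below p : (1 < rk p)%N -> exists q, (q < p)%O.
Proof.
move=> rkp; case: (boolP (minimal_elt p)) => [/(rkP.1 p) rk1|].
  by rewrite rk1 in rkp.
by rewrite /minimal_elt negb_forall => /existsP[q]; rewrite negbK; exists q.
Qed.

Lemma rk_bound p : (0 < rk p <= r)%N.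
Proof.
rewrite (leq_bigmax p) andbT; case: (boolP (minimal_elt p)) => [/(rkP.1 p) -> //|].
rewrite /minimal_elt negb_forall => /existsP[q]; rewrite negbK => /rk_lt.
exact: leq_trans.
Qed.

(** A cover of [q] from below and above [p] has rank one less than [q], so here it differs from
    [p]. *)
Lemma between p q : (p < q)%O -> ((rk p).+1 < rk q)%N ->
  exists2 z, (p < z)%O & (z < q)%O.
Proof.
move=> /lower_cover[z pz zq] rkpq; exists z; last by case/and4P: zq.
rewrite lt_neqAle pz andbT; apply: contraTneq rkpq => ->.
by rewrite (rkP.2 _ _ zq) ltnn.
Qed.

Lemma exists_lower p : (1 < rk p)%N -> exists2 q, (q < p)%O & rk p = (rk q).+1.
Proof.
move=> /exists_below[q /lower_cover[z _ zp]]; exists z; last exact: rkP.2.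
by case/and4P: zp.
Qed.

Lemma chain_cmp C p q : is_chain C -> p \in C -> q \in C -> (p <= q)%O || (q <= p)%O.
Proof. by move=> /forall_inP/(_ p) h /h/forall_inP; apply. Qed.

Lemma chain_rk_lt C p q : is_chain C -> p \in C -> q \in C ->
  (rk p < rk q)%N -> (p < q)%O.
Proof.
move=> cC pC qC rkpq; have := chain_cmp cC pC qC.
rewrite lt_neqAle; case: eqP => [pq|_ /orP[-> //|/rk_le]].
  by rewrite pq ltnn in rkpq.
by rewrite leqNgt rkpq.
Qed.

Lemma chain_rk_inj C : is_chain C -> {in C &, injective rk}.
Proof.
move=> cC p q pC qC rkpq; apply/eqP; apply: contraT => pq.
have := chain_cmp cC pC qC; rewrite !le_eqVlt (negPf pq) eq_sym (negPf pq) /=.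
by case/orP => /rk_lt; rewrite rkpq ltnn.
Qed.

Lemma maximal_chain_chain C : maximal_chain C -> is_chain C.
Proof. by case/maxsetP. Qed.

Lemma maximal_chain_sub C C' : maximal_chain C -> is_chain C' -> C \subset C' -> C' = C.
Proof. by case/maxsetP=> _; apply. Qed.

Lemma maximal_chain_mem C z : maximal_chain C ->
  {in C, forall p, (p <= z)%O || (z <= p)%O} -> z \in C.
Proof.
move=> mC cmp; have cC := maximal_chain_chain mC.
rewrite -(maximal_chain_sub (C' := z |: C) mC) ?setU11 ?subsetUr //.
apply/forall_inP=> p /setU1P[->|pC]; apply/forall_inP=> q /setU1P[->|qC].
- by rewrite lexx.
- by rewrite orbC cmp.
- exact: cmp.
- exact: chain_cmp cC _ _.
Qed.

Lemma maximal_chain_over C : is_chain C ->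
  exists2 C', maximal_chain C' & C \subset C'.
Proof. by move=> /maxset_exists[C' mC CC']; exists C'. Qed.

Lemma singleton_chain p : is_chain [set p].
Proof.
apply/forall_inP=> q /set1P ->; apply/forall_inP=> q' /set1P ->.
by rewrite lexx.
Qed.

(** If rank [i] were skipped, let [q] be the lowest element of [C] of rank at least [i]. Some [z]
    below [q] lies above all elements of [C] of rank less than [i]; maximality puts it into [C],
    where it contradicts the choice of [q]. *)
Lemma maximal_chain_rk C p i : maximal_chain C -> p \in C -> (0 < i <= rk p)%N ->
  exists2 q, q \in C & rk q = i.
Proof.
move=> mC pC /andP[i0 ip]; have cC := maximal_chain_chain mC.
case: (boolP [exists q in C, rk q == i]) => [/exists_inP[q qC /eqP]|/exists_inPn none].
  by exists q.
pose K q := (q \in C) && (i <= rk q)%N; have Kp : K p by rewrite /K pC.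
case: (arg_minnP rk Kp) => q /andP[qC iq] qmin.
have lt_iq : (i < rk q)%N by rewrite ltn_neqAle eq_sym none.
have [z [zq rkz]] : exists z, (z < q)%O /\
    {in C, forall w, (rk w < i)%N -> (w < z)%O}.
  case: (boolP [exists w in C, (rk w < i)%N]) =>
      [/exists_inP[w wC wi]|/exists_inPn none'].
    pose L q := (q \in C) && (rk q < i)%N; have Lw : L w by rewrite /L wC.
    case: (arg_maxnP rk Lw) => v /andP[vC vi] vmax.
    have [||z vz zq] := @between v q.
    - by apply: (chain_rk_lt cC) => //; apply: ltn_trans lt_iq.
    - exact: leq_ltn_trans lt_iq.
    exists z; split=> // u uC ui; apply: le_lt_trans vz.
    have /vmax : L u by rewrite /L uC.
    rewrite /= leq_eqVlt => /predU1P[/(chain_rk_inj cC uC vC) -> //|uv].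
    exact/ltW/(chain_rk_lt cC).
  have [|z zq] := @exists_below q; first exact: leq_ltn_trans lt_iq.
  by exists z; split=> // w wC wi; have := none' w wC; rewrite wi.
suff zC : z \in C.
  have ltz := rk_lt zq; have [zi|iz] := ltnP (rk z) i.
    by have := rkz z zC zi; rewrite ltxx.
  have /qmin /= : K z by rewrite /K zC.
  by rewrite leqNgt ltz.
apply: (maximal_chain_mem mC) => w wC; have [/(rkz w wC)/ltW -> //|iw] := ltnP (rk w) i.
have /qmin : K w by rewrite /K wC.
rewrite /= leq_eqVlt => /predU1P[/(chain_rk_inj cC qC wC) <-|qw].
  by rewrite (ltW zq) orbT.
by rewrite (ltW (lt_trans zq (chain_rk_lt cC qC wC qw))) orbT.
Qed.

(** The top of [C] has rank [r], since otherwise [C] could be extended upwards; [maximal_chain_rk]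
    gives the lower ranks. *)
Lemma maximal_chain_meet C : (forall p, (rk p < r)%N -> exists q, (p < q)%O) ->
  maximal_chain C -> forall i, (0 < i <= r)%N -> exists2 p, p \in C & rk p = i.
Proof.
move=> up mC i /andP[i0 ir]; have cC := maximal_chain_chain mC.
have [p0 _] : exists p0 : P, p0 \in [set: P].
  apply/set0Pn; apply: contraTneq ir => P0; rewrite -ltnNge.
  rewrite /poset_rank big_pred0 // => p.
  by have := in_setT p; rewrite P0 inE.
have [q0 q0C] : exists q, q \in C.
  apply/set0Pn; apply/eqP=> C0; suff : p0 \in C by rewrite C0 inE.
  by apply: (maximal_chain_mem mC) => w; rewrite C0 inE.
case: (arg_maxnP rk q0C) => q qC qmax.
apply: (maximal_chain_rk mC qC); rewrite i0 /=; apply: leq_trans ir _.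
rewrite leqNgt; apply/negP=> /up[z qz].
have : z \in C.
  apply: (maximal_chain_mem mC) => w wC; have := qmax w wC.
  rewrite /= leq_eqVlt => /predU1P[/(chain_rk_inj cC wC qC) ->|wq].
    by rewrite (ltW qz).
  by rewrite (ltW (lt_trans (chain_rk_lt cC wC qC wq) qz)).
by move/qmax; rewrite /= leqNgt rk_lt.
Qed.

(** The edge condition compares consecutive levels only; transitivity through the vertex just below
    [q] reaches the others. The chain is maximal because a further element would repeat a rank. *)
Lemma cell_chain C : cell C -> #|C| = r -> maximal_chain C.
Proof.
move=> cC Cr; have inj := cell_rank_inj cC Cr; have /cellP[meet edge] := cC.
have lt_C : {in C &, forall p q, (rk p < rk q)%N -> (p < q)%O}.
  move=> p q pC qC; have [n] := ubnP (rk q); elim: n q qC => // n IHn q qC qn pq.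
  have [|z zC rkz] := meet (rk q).-1.
    have /andP[q0 qr] := rk_bound q; have /andP[p0 _] := rk_bound p.
    by move: pq qr; case: (rk q) q0 => // m _;
      rewrite /= ltnS => /(leq_trans p0) -> /ltnW.
  have rkq : rk q = (rk z).+1 by rewrite rkz prednK // (leq_ltn_trans _ pq).
  have zq : (z < q)%O by apply: edge.
  move: pq; rewrite rkq ltnS leq_eqVlt => /predU1P[/inj-> //|pz].
  by apply: lt_trans zq; apply: IHn => //; rewrite -ltnS -rkq.
apply/maxsetP; split=> [|C' cC' CC'].
  apply/forall_inP=> p pC; apply/forall_inP=> q qC.
  by case: (ltngtP (rk p) (rk q)) => [/lt_C/ltW->|/lt_C/ltW->|/inj->];
    rewrite ?orbT ?lexx.
apply/eqP; rewrite eqEsubset CC' andbT; apply/subsetP=> w wC'.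
have [p pC rkp] := meet (rk w) (rk_bound w).
by rewrite -(chain_rk_inj cC' (subsetP CC' p pC) wC' rkp).
Qed.

Lemma maximal_chainE C : (forall p, (rk p < r)%N -> exists q, (p < q)%O) ->
  maximal_chain C = cell C && (#|C| == r).
Proof.
move=> up; apply/idP/andP=> [mC|[cC /eqP]]; last exact: cell_chain.
have cC := maximal_chain_chain mC.
have cellC : cell C.
  apply/cellP; split; first exact: maximal_chain_meet.
  by move=> p q pC qC rkpq; apply: (chain_rk_lt cC); rewrite // rkpq.
split=> //; rewrite eqn_leq (cell_card cellC) andbT.
exact: (rank_inj_card rk_bound (chain_rk_inj cC)).
Qed.

Lemma hasse_consecutive i p q : rk p = i -> rk q = i.+1 ->
  hasse_in (consecutive_levels rk i) p q = (p < q)%O.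
Proof.
move=> rkp rkq; apply/idP/idP=> [/orP[/and4P[]//|/and4P[_ _ /rk_lt]]|pq].
  by rewrite rkp rkq ltnNge leqnSn.
rewrite /hasse_in /covers_in !inE pq rkp rkq !eqxx orbT /=.
apply/orP; left; apply/forall_inP=> z _; apply/negP=> /andP[/rk_lt pz /rk_lt zq].
by have := leq_ltn_trans pz zq; rewrite rkp rkq ltnn.
Qed.

End GradedPoset.

(** * Ferrers levels *)

(** Applied with [f] the size of a neighbourhood: small labels get large neighbourhoods. The element
    [p0] makes the number of labels a successor. *)
Lemma sorted_labels (T : finType) (X : {set T}) (f : T -> nat) p0 : p0 \in X ->
  exists (n : nat) (x : 'I_n.+1 -> T), [/\ injective x, x @: 'I_n.+1 = X &
    forall i j : 'I_n.+1, (i <= j)%N -> (f (x j) <= f (x i))%N].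
Proof.
move=> p0X; pose s := sort (fun p q => f q <= f p)%N (enum X).
have mem_s p : (p \in s) = (p \in X) by rewrite mem_sort mem_enum.
have us : uniq s by rewrite sort_uniq enum_uniq.
have s_gt0 : (0 < size s)%N by rewrite -has_predT; apply/hasP; exists p0; rewrite ?mem_s.
have ss : sorted (fun p q => f q <= f p)%N s.
  by apply: sort_sorted => p q; apply: leq_total.
have lt_s (i : 'I_(size s).-1.+1) : (i < size s)%N by rewrite -[X in (_ < X)%N]prednK.
exists (size s).-1, (fun i => nth p0 s i); split.
- by move=> i j /eqP; rewrite nth_uniq // => /eqP/val_inj.
- apply/setP=> p; rewrite -mem_s; apply/imsetP/idP=> [[i _ ->]|ps].
    exact: mem_nth.
  have lt_p : (index p s < (size s).-1.+1)%N by rewrite prednK // index_mem.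
  by exists (Ordinal lt_p); rewrite //= nth_index.
- have tr : transitive (fun p q => f q <= f p)%N.
    by move=> q p q' /= qp qq'; apply: leq_trans qq' qp.
  have rf : reflexive (fun p q => f q <= f p)%N by move=> q /=.
  by move=> i j ij; apply: (sorted_leq_nth tr rf p0 ss); rewrite ?inE.
Qed.

Section FerrersLevels.
Variables (d : Order.disp_t) (P : finPOrderType d) (rk : P -> nat).
Hypothesis rkP : rank_function rk.
Local Notation r := (poset_rank rk).
Implicit Types (p q : P) (C : {set P}).

Local Notation ferrers_levels := (forall i : nat, (1 <= i <= r - 1)%N ->
  ferrers_graph (rank_level rk i) (rank_level rk i.+1)
    (hasse_in (consecutive_levels rk i))).

Lemma label_rk n (x : 'I_n.+1 -> P) i : x @: 'I_n.+1 = rank_level rk i ->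
  (forall a, rk (x a) = i) /\ (forall p, rk p = i -> exists a, p = x a).
Proof.
move=> xE; split=> [a|p rkp].
  have : x a \in rank_level rk i by rewrite -xE; apply: imset_f.
  by rewrite inE => /eqP.
have : p \in rank_level rk i by rewrite inE rkp.
by rewrite -xE => /imsetP[a _ ->]; exists a.
Qed.

Lemma ferrers_levels_labels i : ferrers_levels -> (0 < i)%N -> (i < r)%N ->
  exists n m (x : 'I_n.+1 -> P) (y : 'I_m.+1 -> P),
  [/\ (forall a, rk (x a) = i) /\ (forall p, rk p = i -> exists a, p = x a),
      (forall b, rk (y b) = i.+1) /\ (forall p, rk p = i.+1 -> exists b, p = y b),
      forall a b, (x a < y b)%O ->
        forall (a' : 'I_n.+1) (b' : 'I_m.+1), (a' <= a)%N -> (b' <= b)%N ->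
        (x a' < y b')%O
    & (x ord0 < y ord_max)%O /\ (x ord_max < y ord0)%O].
Proof.
move=> fer i0 ir; have [|_ [n [m [x [y [[_ xE] [_ yE] closed [c1 c2]]]]]]] := fer i.
  by rewrite i0 leq_subRL ?add1n // (leq_ltn_trans _ ir).
have [rkx xs] := label_rk xE; have [rky ys] := label_rk yE.
have hE a b : hasse_in (consecutive_levels rk i) (x a) (y b) = (x a < y b)%O.
  exact: hasse_consecutive.
exists n, m, x, y; rewrite -!hE; split=> // a b; rewrite -hE => ab a' b' aa bb.
by rewrite -hE; apply: closed ab _ _ aa bb.
Qed.

(** By the corner edge from [x ord_max] to [y ord0], every element of the lower level lies below
    [y ord0]. *)
Lemma ferrers_up : ferrers_levels -> forall p, (rk p < r)%N -> exists q, (p < q)%O.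
Proof.
move=> fer p rkp; have /andP[p0 _] := rk_bound rkP p.
have [n [m [x [y [[_ xs] _ closed [_ corner]]]]]] := ferrers_levels_labels fer p0 rkp.
have [a ->] := xs p erefl; exists (y ord0).
by apply: closed corner _ _ _ _; rewrite // -ltnS ltn_ord.
Qed.

(** Lower neighbourhoods shrink as the label of the upper vertex grows. *)
Lemma ferrers_nested : ferrers_levels -> forall p p', rk p = rk p' ->
  (forall q, rk p = (rk q).+1 -> (q < p)%O -> (q < p')%O) \/
  (forall q, rk p = (rk q).+1 -> (q < p')%O -> (q < p)%O).
Proof.
move=> fer p p' eq_rk; have [rkp|rkp] := leqP (rk p) 1.
  (* On level 1 there are no lower neighbours to compare. *)
  left=> q rkq; have /andP[] := rk_bound rkP q.
  by rewrite -ltnS -rkq => /(leq_trans)/(_ rkp).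
case rkpE : (rk p) => [|i]; first by rewrite rkpE in rkp.
have i0 : (0 < i)%N by rewrite -ltnS -rkpE.
have ir : (i < r)%N by rewrite -rkpE; have /andP[] := rk_bound rkP p.
have [n [m [x [y [[_ xs] [_ ys] closed _]]]]] := ferrers_levels_labels fer i0 ir.
have [b pE] := ys p rkpE; have [b' p'E] := ys p' (etrans (esym eq_rk) rkpE).
rewrite {}pE {}p'E; have [bb|/ltnW bb] := leqP b b'; [right|left] => q [] rkq;
  by have [a ->] := xs q (esym rkq); move=> ab; apply: closed ab _ _ _ bb.
Qed.

(** The corners join [x ord0] to all [y b] and [y ord0] to all [x a], so levels 1 and 2 are
    connected; higher elements are reached by descending. *)
Lemma ferrers_connected : (1 < r)%N -> ferrers_levels -> poset_connected P.
Proof.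
move=> r1 fer; pose adj := fun p q : P => (p <= q)%O || (q <= p)%O.
have csym : connect_sym adj.
  by apply: sym_connect_sym => p q; rewrite /adj orbC.
have ltc p q : (p < q)%O -> connect adj p q.
  by move=> /ltW pq; apply: connect1; rewrite /adj pq.
have lev i : (0 < i)%N -> (i < r)%N -> exists c, forall p,
    (rk p == i) || (rk p == i.+1) -> connect adj c p.
  move=> i0 ir.
  have [n [m [x [y [[_ xs] [_ ys] closed [c1 c2]]]]]] := ferrers_levels_labels fer i0 ir.
  exists (x ord0); have xy b : connect adj (x ord0) (y b).
    by apply/ltc/(closed _ _ c1); rewrite // -ltnS ltn_ord.
  move=> p /orP[/eqP/xs[a ->]|/eqP/ys[b ->] //].
  apply: connect_trans (xy ord0) _; rewrite csym; apply: ltc.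
  by apply: (closed _ _ c2); rewrite // -ltnS ltn_ord.
have [c0 c0P] := lev 1%N isT r1.
suff c0c n p : (rk p <= n)%N -> connect adj c0 p.
  move=> p q; apply: connect_trans (c0c _ q (leqnn _)).
  by rewrite csym; apply: c0c (leqnn _).
elim: n p => [|n IHn] p.
  by have /andP[] := rk_bound rkP p; rewrite ltnNge => /negPf ->.
rewrite leq_eqVlt => /predU1P[rkp|]; last exact: IHn.
case: n => [|n] in rkp IHn *; first by apply: c0P; rewrite rkp.
have [|c cP] := lev n.+1 isT.
  by rewrite -rkp; have /andP[] := rk_bound rkP p.
have [|q qp rkq] := @exists_lower _ _ _ rkP p; first by rewrite rkp.
by apply: connect_trans (ltc _ _ qp); apply: IHn; rewrite -ltnS -rkq rkp.
Qed.

(** * From pure chains and nested neighbourhoods to Ferrers graphs *)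

Section FromChains.
Variable n : nat.
Hypothesis pure : forall C : {set P}, @maximal_chain d P C -> #|C| = n.

(** A maximal chain through an element of top rank has one element on each level, so the common size
    is [r]. *)
Lemma pure_card C : (0 < r)%N -> maximal_chain C -> #|C| = r.
Proof.
move=> r0 mC; rewrite (pure mC); have [m rkm] : exists m, rk m = r.
  have [p0 _|P0] := pickP (fun _ : P => true).
    have card_P : (0 < #|P|)%N by apply/card_gt0P; exists p0.
    by have [m rE] := @bigop.eq_bigmax P rk card_P; exists m.
  by rewrite /poset_rank big_pred0 in r0.
have [C' mC' /subsetP CC'] := maximal_chain_over (singleton_chain m).
have cC' := maximal_chain_chain mC'.
apply/eqP; rewrite -(pure mC') eqn_leq (rank_inj_card (rk_bound rkP)); last first.
  exact: (chain_rk_inj rkP cC').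
rewrite -[X in (X <= _)%N](card_levels r).
apply: leq_trans (leq_imset_card (fun p => inord (rk p) : 'I_r.+1) _).
apply/subset_leq_card/subsetP=> i; rewrite inE -val_eqE /= -lt0n => i0.
have [||p pC' rkp] := maximal_chain_rk (i := i) rkP mC' (p := m).
- by rewrite CC' ?inE.
- by rewrite i0 rkm -ltnS ltn_ord.
by apply/imsetP; exists p => //; apply/val_inj; rewrite /= rkp inordK.
Qed.

Lemma pure_meet C i : maximal_chain C -> (0 < i <= r)%N ->
  exists2 p, p \in C & rk p = i.
Proof.
move=> mC ir; have r0 : (0 < r)%N by case/andP: ir; apply: leq_trans.
apply: (rank_inj_meet (rk_bound rkP) (chain_rk_inj rkP (maximal_chain_chain mC))) ir.
exact: pure_card.
Qed.

Lemma pure_upper p : (rk p < r)%N -> exists2 q, (p < q)%O & rk q = (rk p).+1.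
Proof.
move=> rkp; have [C mC /subsetP pC] := maximal_chain_over (singleton_chain p).
have [|q qC rkq] := @pure_meet C (rk p).+1 mC; first by [].
exists q => //; apply: (chain_rk_lt rkP (maximal_chain_chain mC)); rewrite ?rkq //.
by rewrite pC ?inE.
Qed.

(** No two disjoint edges between consecutive levels form an induced subgraph, so neighbourhoods are
    nested. *)
Hypothesis no_gap : forall a a' b b' : P,
  rk a = rk a' -> rk b = rk b' -> rk b = (rk a).+1 ->
  (a < b)%O -> (a' < b')%O -> (a < b')%O || (a' < b)%O.

Lemma pure_ferrers : ferrers_levels.
Proof.
move=> i /andP[i0 ir1].
have ir : (i < r)%N.
  (* Truncated subtraction: for [r = 0] the bound is 0, which [i0] excludes. *)
  by move: ir1; case: r => [|m]; rewrite ?subn1 //=; case: (i) i0.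
have [p0 rkp0 {ir1}] : exists p, rk p = i.
  have [p0 _|P0] := pickP (fun _ : P => true); last first.
    by move: ir; rewrite /poset_rank big_pred0.
  have [C mC _] := maximal_chain_over (singleton_chain p0).
  by have [|p _ <-] := @pure_meet C i mC; [rewrite i0 ltnW|exists p].
have [q0 _ rkq0] : exists2 q, (p0 < q)%O & rk q = (rk p0).+1.
  by apply: pure_upper; rewrite rkp0.
have p0X : p0 \in rank_level rk i by rewrite inE rkp0.
have q0Y : q0 \in rank_level rk i.+1 by rewrite inE rkq0 rkp0.
pose up p := [set q | (rk q == i.+1) && (p < q)%O].
pose dn q := [set p | (rk p == i) && (p < q)%O].
have [n1 [x [injx xE xle]]] := sorted_labels (fun p => #|up p|) p0X.
have [m1 [y [injy yE yle]]] := sorted_labels (fun q => #|dn q|) q0Y.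
have [rkx xs] := label_rk xE; have [rky ys] := label_rk yE.
have hE a b : hasse_in (consecutive_levels rk i) (x a) (y b) = (x a < y b)%O.
  exact: hasse_consecutive.
(* A neighbour of [x a] missed by [x a'] would, by [no_gap], make the neighbourhood of [x a']
   strictly smaller, against the sorting. *)
have upx (a a' : 'I_n1.+1) q : (a' <= a)%N -> rk q = i.+1 -> (x a < q)%O -> (x a' < q)%O.
  move=> aa rkq aq; apply: contraT => a'q.
  have : up (x a') \proper up (x a).
    apply/properP; split; last by exists q; rewrite inE rkq eqxx.
    apply/subsetP=> q'; rewrite !inE => /andP[/eqP rkq' a'q']; rewrite rkq' eqxx.
    have := @no_gap (x a) (x a') q q'.
    by rewrite !rkx rkq rkq' (negPf a'q) orbF; apply.
  by move/proper_card; rewrite ltnNge xle.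
have dny (b b' : 'I_m1.+1) p : (b' <= b)%N -> rk p = i -> (p < y b)%O -> (p < y b')%O.
  move=> bb rkp pb; apply: contraT => pb'.
  have : dn (y b') \proper dn (y b).
    apply/properP; split; last by exists p; rewrite inE rkp eqxx.
    apply/subsetP=> p'; rewrite !inE => /andP[/eqP rkp' p'b']; rewrite rkp' eqxx.
    have := @no_gap p p' (y b) (y b').
    by rewrite !rky rkp rkp' (negPf pb') /=; apply.
  by move/proper_card; rewrite ltnNge yle.
split; last first.
  exists n1, m1, x, y; split=> //.
    move=> a b; rewrite hE => ab a' b' aa bb; rewrite hE.
    by apply: (upx a) => //; apply: (dny b).
  (* Corners: some lower neighbour of the last [y] can be moved to the first [x], and some upper
     neighbour of the last [x] to the first [y]. *)
  rewrite !hE; split.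
    have [|a qa rka] := @exists_lower _ _ _ rkP (y ord_max); first by rewrite rky.
    have [|a0 aE] := xs a; first by move: rka; rewrite rky => -[].
    by apply: (upx a0); rewrite // -aE.
  have [|q qa] := @pure_upper (x ord_max); first by rewrite rkx.
  rewrite rkx => /ys[b qE]; apply: (dny b) => //; by rewrite -qE.
split.
- rewrite -setI_eq0; apply/eqP/setP=> p; rewrite !inE.
  by case: eqP => // ->; rewrite ltn_eqF.
- by move=> p q; rewrite /hasse_in orbC.
have cov p q : covers_in (consecutive_levels rk i) p q -> (rk p == i) && (rk q == i.+1).
  rewrite /covers_in !inE => /and4P[pi qi /(rk_lt rkP) + _].
  case/orP: pi => /eqP ->; case/orP: qi => /eqP ->;
    by rewrite ?eqxx ?ltnn // ltnNge leqnSn.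
by move=> p q /orP[/cov|/cov]; rewrite !inE => /andP[-> ->]; rewrite ?orbT.
Qed.

End FromChains.
End FerrersLevels.

(** * Syzygies of a linear flag ideal *)

Section MonomialPart.
Variables (n : nat) (R : comNzRingType).
Implicit Types (f g : {mpoly R[n]}) (m : 'X_{1..n}).

(** A linear projection, used to keep only the chains through two given elements in a generator. *)
Definition mpart (Q : pred 'X_{1..n}) f : {mpoly R[n]} :=
  \sum_(m <- msupp f | Q m) f@_m *: 'X_[m].

Lemma mcoeff_mpart Q f m : (mpart Q f)@_m = if Q m then f@_m else 0.
Proof.
transitivity (\sum_(m' <- msupp f) if Q m' then f@_m' *+ (m' == m) else 0).
  rewrite /mpart big_mkcond raddf_sum; apply: eq_bigr => m' _ /=.
  by case: ifP; rewrite ?mcoeff0 // mcoeffZ mcoeffX mulr_natr.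
case: ifP => Qm.
  rewrite [in RHS](mpolyE f) raddf_sum; apply: eq_bigr => m' _ /=.
  rewrite mcoeffZ mcoeffX mulr_natr; case: (eqVneq m' m) => [->|_]; first by rewrite Qm.
  by rewrite mulr0n if_same.
apply: big1 => m' _; case: (eqVneq m' m) => [->|_]; first by rewrite Qm.
by rewrite mulr0n if_same.
Qed.

Lemma mcoeffM_neq0 f g m : (f * g)@_m != 0 ->
  exists m1 m2, [/\ m = (m1 + m2)%MM, f@_m1 != 0 & g@_m2 != 0].
Proof.
rewrite -mcoeff_msupp => /msuppM_le/allpairsP[[m1 m2] /= [m1f m2g ->]].
by exists m1, m2; rewrite -!mcoeff_msupp.
Qed.

(* [Q] need only be constant on the monomials of [g] that contribute to the
   coefficient at [m]. *)
Lemma mcoeffM_mpart (Q : pred 'X_{1..n}) (q : bool) f g m :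
  (forall m1 m2, m = (m1 + m2)%MM -> f@_m1 != 0 -> g@_m2 != 0 -> Q m2 = q) ->
  (f * mpart Q g)@_m = if q then (f * g)@_m else 0.
Proof.
move=> constQ; rewrite !mcoeffM.
transitivity (\sum_(m12 : 'X_{1..n < (mdeg m).+1, (mdeg m).+1} | m == (m12.1 + m12.2)%MM)
    if q then f@_m12.1 * g@_m12.2 else 0).
  apply: eq_bigr => -[m1 m2] /= /eqP mE; rewrite mcoeff_mpart.
  have [->|f0] := eqVneq f@_m1 0; first by rewrite !mul0r if_same.
  have [->|g0] := eqVneq g@_m2 0; first by rewrite if_same mulr0 if_same.
  by rewrite (constQ m1 m2) //; case: ifP; rewrite ?mulr0.
by case: ifP => // _; rewrite big1.
Qed.

End MonomialPart.

(** * Purity of maximal chains and exclusion of induced disjoint edges *)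

Section LinearFlagIdeal.
Variables (d : Order.disp_t) (P : finPOrderType d) (rk : P -> nat) (k : fieldType).
Hypothesis rkP : rank_function rk.
Local Notation S := {mpoly k[#|P|]}.
Local Notation I := (@flag_ideal d P k).
Local Notation sX C := 'X_[k, @set_mnm P C].
Implicit Types (C : {set P}) (m : 'X_{1..#|P|}).

Lemma chain_monomialE C : chain_monomial k C = sX C.
Proof. exact: prod_set_mnm. Qed.

Lemma flag_ideal_chain C : maximal_chain C -> I (sX C).
Proof.
move=> mC; exists (fun C' => if C' == C then 1 else 0).
rewrite (bigD1 C) //= eqxx mul1r chain_monomialE big1 ?addr0 // => C' /andP[_ /negPf ->].
exact: mul0r.
Qed.

Lemma flag_ideal_supp f m : I f -> f@_m != 0 ->
  exists2 C, maximal_chain C & (set_mnm C <= m)%MM.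
Proof.
move=> [c ->]; case: (boolP [exists C : {set P}, maximal_chain C && (set_mnm C <= m)%MM]).
  by case/existsP=> C /andP[mC le]; exists C.
rewrite negb_exists => /forallP none; rewrite raddf_sum big1 ?eqxx // => C mC /=.
apply/eqP; apply: contraT; rewrite chain_monomialE => /mcoeffMX_neq0 le.
by have := none C; rewrite mC le.
Qed.

Lemma set_mnm_sub C C' : (set_mnm C <= set_mnm C')%MM -> C \subset C'.
Proof.
rewrite set_mnm_le => /subset_trans; apply; apply/subsetP=> p.
by rewrite inE set_mnmE; case: (p \in C').
Qed.

Lemma set_mnm_eq C m : (set_mnm C <= m)%MM -> (mdeg m <= #|C|)%N -> m = set_mnm C.
Proof.
move=> le; rewrite -(submK le) mdegD mdeg_set_mnm -{2}[#|C|]add0n leq_add2r leqn0.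
by rewrite mdeg_eq0 => /eqP ->; rewrite add0m.
Qed.

Lemma mdeg_le m m' : (m <= m')%MM -> (mdeg m <= mdeg m')%N.
Proof. by move=> le; rewrite -(submK le) mdegD leq_addl. Qed.

Variable F : graded_free_resolution I.
Variable D : nat.
Hypothesis shiftE : forall i (v : 'I_(gfr_rank F i)), gfr_shift v = (D + i)%N.

Lemma gfr_aug_mem v : I (gfr_aug F v ord0).
Proof.
apply/(gfr_image_aug F); exists (delta_mx ord0 v).
by rewrite -rowE mxE.
Qed.

Lemma gfr_aug_deg v m : (gfr_aug F v ord0)@_m != 0 -> mdeg m = D.
Proof.
rewrite -mcoeff_msupp; have := gfr_aug_homog (g := F) v; rewrite shiftE addn0.
by move/dhomogP; apply.
Qed.

(** Some monomial of a generator divides that of [C] and is divisible by that of a maximal chain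
    [C']. Maximality gives [C' = C], so its degree [D] is the size of [C]. *)
Lemma linear_pure C : maximal_chain C -> #|C| = D.
Proof.
move=> mC; have [w wE] := (gfr_image_aug F _).1 (flag_ideal_chain mC).
have : (sX C)@_(set_mnm C) != 0 by rewrite mcoeffX eqxx oner_eq0.
rewrite wE mxE raddf_sum; case: (boolP [exists v,
    (w ord0 v * gfr_aug F v ord0)@_(set_mnm C) != 0]); last first.
  rewrite negb_exists => /forallP none; rewrite big1 ?eqxx // => v _.
  by apply/eqP; have := none v; rewrite negbK.
case/existsP=> v /mcoeffM_neq0[m1 [m2 [mE _ augm]]] _.
have [C' mC' leC'] := flag_ideal_supp (gfr_aug_mem v) augm.
have le2 : (m2 <= set_mnm C)%MM by rewrite mE lem_addl.
have CC' : C = C'.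
  apply: (maximal_chain_sub mC' (maximal_chain_chain mC)).
  exact/set_mnm_sub/(lepm_trans leC').
apply/eqP; rewrite -(gfr_aug_deg augm) eqn_leq -(mdeg_set_mnm C).
by rewrite {1}CC' !mdeg_le.
Qed.

Lemma gfr_aug_supp v m : (gfr_aug F v ord0)@_m != 0 ->
  exists2 C, maximal_chain C & m = set_mnm C.
Proof.
move=> augm; have [C mC le] := flag_ideal_supp (gfr_aug_mem v) augm.
by exists C => //; apply: set_mnm_eq le _; rewrite (gfr_aug_deg augm) linear_pure.
Qed.

(* If neither [a < b'] nor [a' < b], then the maximal chains inside the union
   of [C] and [C'] containing [a] and [b] and those containing [a'] and [b']
   differ in two elements, so no linear syzygy relates them; but the Taylor
   syzygy of [C] and [C'] does. *)
Lemma linear_no_gap a a' b b' :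
  rk a = rk a' -> rk b = rk b' -> rk b = (rk a).+1 ->
  (a < b)%O -> (a' < b')%O -> (a < b')%O || (a' < b)%O.
Proof.
move=> rkaa rkbb rkab ab ab'; apply: contraT; rewrite negb_or => /andP[nab' na'b].
have chain2 (p q : P) : (p < q)%O -> is_chain [set p; q].
  move=> /ltW pq; apply/forall_inP=> u /set2P[]->; apply/forall_inP=> v /set2P[]->;
  by rewrite ?lexx ?pq ?orbT.
have [C mC /subsetP abC] := maximal_chain_over (chain2 _ _ ab).
have [C' mC' /subsetP abC'] := maximal_chain_over (chain2 _ _ ab').
have [aC bC] : a \in C /\ b \in C by rewrite !abC ?inE ?eqxx ?orbT.
have [aC' bC'] : a' \in C' /\ b' \in C' by rewrite !abC' ?inE ?eqxx ?orbT.
have inj := fun C (mC : maximal_chain C) => chain_rk_inj rkP (maximal_chain_chain mC).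
pose Q m := (m (enum_rank a) != 0%N) && (m (enum_rank b) != 0%N).
have QE A : Q (set_mnm A) = (a \in A) && (b \in A).
  by rewrite /Q !set_mnmE; do 2!case: (_ \in A).
pose U := set_mnm (C :|: C').
(* The augmentation restricted to chains through [a] and [b]. At the exponent [U] of the least
   common multiple it will vanish on all syzygies, yet equal 1 on the Taylor syzygy. *)
pose Phi (w : 'rV[S]_(gfr_rank F 0)) := \sum_v w ord0 v * mpart Q (gfr_aug F v ord0).
have PhiE (w : 'rV[S]_(gfr_rank F 0)) m q :
    (forall v m1 m2, m = (m1 + m2)%MM -> (w ord0 v)@_m1 != 0 ->
       (gfr_aug F v ord0)@_m2 != 0 -> Q m2 = q) ->
    (Phi w)@_m = if q then ((w *m gfr_aug F) ord0 ord0)@_m else 0.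
  move=> constQ; rewrite mxE !raddf_sum /=.
  under eq_bigr => v _ do rewrite (mcoeffM_mpart (constQ v)).
  by case: ifP => // _; rewrite big1.
have Phi_syz u m : (m <= U)%MM -> (Phi (row u (gfr_diff F 0)))@_m = 0.
  (* All chains contributing at [m] agree on [Q], so the coefficient is 0 or that of the full
     augmentation, which vanishes on syzygies. *)
  move=> mU; pose qm := [exists A : {set P},
    [&& maximal_chain A, (set_mnm A <= m)%MM & Q (set_mnm A)]].
  rewrite (PhiE _ _ qm).
    have -> : row u (gfr_diff F 0) *m gfr_aug F = 0.
      by apply/gfr_exact_aug; exists (delta_mx ord0 u); rewrite -rowE.
    by rewrite mxE mcoeff0 if_same.
  move=> v m1 m2 mE; rewrite mxE => diff_m1 /gfr_aug_supp[A mA m2E].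
  have m1E : mdeg m1 = 1%N.
    have := gfr_diff_homog (g := F) u v; rewrite !shiftE addn0 addn1 leqnSn subSnn.
    by move/dhomogP; apply; rewrite mcoeff_msupp.
  have Am : (set_mnm A <= m)%MM by rewrite mE -m2E lem_addl.
  rewrite m2E; apply/idP/existsP=> [QA|[B /and3P[mB Bm QB]]].
    by exists A; rewrite mA Am QA.
  have AU : A \subset C :|: C' by apply/set_mnm_sub/(lepm_trans Am).
  have meetA p : exists2 q, q \in A & rk q = rk p.
    exact: (pure_meet rkP linear_pure mA (rk_bound rkP p)).
  (* Within the union of [C] and [C'] the level of [p] contains only [p] and [p'], and [A] meets
     it. *)
  have inA p p' : p \in C -> p' \in C' -> rk p = rk p' -> p \notin A -> p' \in A.
    move=> pC p'C' rkp pA; have [q qA rkq] := meetA p.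
    have /setUP[qC|qC'] := subsetP AU q qA.
      by rewrite -(inj C mC q p qC pC rkq) qA in pA.
    by rewrite -(inj C' mC' q p' qC' p'C') // rkq.
  have ltA := chain_rk_lt rkP (maximal_chain_chain mA).
  have {}ltA p q : p \in A -> q \in A -> rk q = (rk p).+1 -> (p < q)%O.
    by move=> pA qA rkq; apply: ltA; rewrite // rkq.
  rewrite QE; move: QB; rewrite QE => /andP[aB bB].
  (* If [A] contains just one of [a] and [b], it contains the primed partner of the other, giving an
     excluded comparison. If it contains neither, [m] is divisible by [A] and two further variables,
     but its degree exceeds the size of [A] by only 1. *)
  have [aA|aA] := boolP (a \in A); have [bA|bA] := boolP (b \in A) => //=.
  - have b'A := inA b b' bC bC' rkbb bA.
    by rewrite ltA // -?rkbb in nab'.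
  - have a'A := inA a a' aC aC' rkaa aA.
    by rewrite ltA // -?rkaa in na'b.
  have : (set_mnm (a |: (b |: A)) <= m)%MM.
    rewrite !set_mnm_le in Am Bm *; rewrite !subUset !sub1set Am.
    by rewrite !(subsetP Bm).
  have ab_neq : a != b by rewrite lt_eqF.
  move/mdeg_le; rewrite mdeg_set_mnm mE mdegD m1E m2E mdeg_set_mnm.
  by rewrite !cardsU1 !inE (negPf ab_neq) aA bA /= !add1n ltnn.
have [w wE] := (gfr_image_aug F _).1 (flag_ideal_chain mC).
have [w' w'E] := (gfr_image_aug F _).1 (flag_ideal_chain mC').
have PhiC (w0 : 'rV[S]_(gfr_rank F 0)) A : maximal_chain A ->
    (Phi w0)@_(set_mnm A) =
    if Q (set_mnm A) then ((w0 *m gfr_aug F) ord0 ord0)@_(set_mnm A) else 0.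
  move=> mA; apply: PhiE => v m1 m2 mE _ /gfr_aug_supp[B mB m2E].
  congr Q; rewrite m2E; congr set_mnm; apply/esym.
  apply: (maximal_chain_sub mB (maximal_chain_chain mA)); apply: set_mnm_sub.
  by rewrite -m2E mE lem_addl.
(* The Taylor syzygy of [C] and [C'], lifted to the free module. *)
pose W := 'X_[k, U - set_mnm C] *: w - 'X_[k, U - set_mnm C'] *: w'.
have leU (A : {set P}) : A \subset C :|: C' -> (set_mnm A <= U)%MM.
  rewrite set_mnm_le => /subset_trans; apply; apply/subsetP=> p.
  by rewrite [in X in _ -> X]inE set_mnmE => ->.
have augE (v : 'rV[S]_(gfr_rank F 0)) A :
    (v *m gfr_aug F) ord0 ord0 = sX A -> v *m gfr_aug F = const_mx (sX A).
  by move=> vE; apply/matrixP=> i j; rewrite !ord1 vE mxE.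
have [z zE] : exists z, W = z *m gfr_diff F 0.
  apply/gfr_exact_aug; rewrite mulmxBl -!scalemxAl (augE _ C) // (augE _ C') //.
  apply/matrixP=> i j; rewrite !mxE -!mpolyXD !submK ?subrr //.
    by rewrite leU ?subsetUr.
  by rewrite leU ?subsetUl.
have PhiW : Phi W = 'X_[k, U - set_mnm C] * Phi w - 'X_[k, U - set_mnm C'] * Phi w'.
  rewrite !mulr_sumr -sumrB; apply: eq_bigr => v _.
  by rewrite !mxE mulrBl !mulrA.
have Phi0 : (Phi W)@_U = 0.
  have -> : Phi W = \sum_u z ord0 u * Phi (row u (gfr_diff F 0)).
    rewrite zE; under [RHS]eq_bigr do rewrite mulr_sumr.
    rewrite exchange_big; apply: eq_bigr => v _; rewrite mxE mulr_suml.
    by apply: eq_bigr => u _; rewrite mxE mulrA.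
  rewrite raddf_sum big1 // => u _; apply/eqP; apply: contraT.
  move=> /mcoeffM_neq0[m1 [m2 [UE _]]]; rewrite Phi_syz ?eqxx //.
  by rewrite UE lem_addl.
have coefU (A : {set P}) (f : S) : A \subset C :|: C' ->
    ('X_[k, U - set_mnm A] * f)@_U = f@_(set_mnm A).
  by move=> /leU AU; rewrite -{1}(submK AU) mulrC mcoeffMX.
move: Phi0; rewrite PhiW mcoeffB !coefU ?subsetUl ?subsetUr // !PhiC // !QE aC bC /=.
(* So [C] contributes 1 and [C'] contributes 0: if [a] were in [C'], it would equal [a'], which is
   not below [b]. *)
have /negPf-> : a \notin C'.
  apply/negP=> aC'2; have aa' := inj C' mC' a a' aC'2 aC' rkaa.
  by rewrite -aa' ab in na'b.
by rewrite -wE mcoeffX eqxx subr0 => /eqP; rewrite oner_eq0.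
Qed.

End LinearFlagIdeal.

(** * The equivalence and connectedness *)

Theorem theorem6p3 (k : fieldType) (d : Order.disp_t) (P : finPOrderType d)
    (rk : P -> nat) (r : nat)
    (rkP : rank_function rk) (rE : r = poset_rank rk) :
  (has_linear_resolution (@flag_ideal d P k) <->
     forall i : nat, (1 <= i <= r - 1)%N ->
       ferrers_graph (rank_level rk i) (rank_level rk i.+1)
         (hasse_in (consecutive_levels rk i)))
  /\ ((1 < r)%N -> has_linear_resolution (@flag_ideal d P k) ->
        poset_connected P).
Proof.
rewrite {}rE; have lin_fer : has_linear_resolution (@flag_ideal d P k) ->
    forall i : nat, (1 <= i <= poset_rank rk - 1)%N ->
      ferrers_graph (rank_level rk i) (rank_level rk i.+1)
        (hasse_in (consecutive_levels rk i)).
  case=> F _ [D shiftE]; apply: (pure_ferrers rkP (linear_pure shiftE)).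
  exact: (linear_no_gap rkP shiftE).
split; last by move=> r1 /lin_fer; apply: ferrers_connected.
split=> // fer.
apply: (cell_resolution_linear (rk_bound rkP) (ferrers_nested rkP fer)) => f.
split=> -[c ->]; exists c; apply: eq_big => C.
- exact: (maximal_chainE rkP C (ferrers_up rkP fer)).
- by rewrite chain_monomialE.
- by rewrite (maximal_chainE rkP C (ferrers_up rkP fer)).
- by rewrite chain_monomialE.
Qed.
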